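(* Consider the linear model with systematic group bias described in the context, and let $p,K\in\mathbb{N}$, $t\ge0$. Define $$\delta_n=\delta_n(p,K,t)=8\Big(\frac{p}{n}+\frac{K}{n}\Big)+16\Big(\sqrt{\frac pn}+\sqrt{\frac Kn}\Big)\sqrt{\frac tn}+\frac{32t}{n},\qquad \theta(p,K,t)=\frac{4\sqrt K+5\sqrt t+6\sqrt p}{\sqrt p+\sqrt t},$$ and, for $\alpha\in[0,1]$, $$\hat\tau=\begin{cases}\alpha\Big(1+\dfrac{\sigma\delta_n^{1/2}}{\mathcal{U}^{1/2}(\hat f_1)-\sigma\delta_n^{1/2}}\Big)^{-2}&\text{if }\mathcal{U}^{1/2}(\hat f_1)>\sigma\delta_n^{1/2},\\ 0&\text{otherwise.}\end{cases}$$ Assume $\sqrt n\ge 2(\sqrt p+\sqrt t)/\big(\theta(p,K,t)-\sqrt{\theta^2(p,K,t)-3}\big)$. Then for any $\alpha\in[0,1]$, with probability at least $1-4\exp(-t/2)$, $$\mathcal{U}(\hat f_{\hat\tau})\le\alpha\,\mathcal{U}(f^* )\quad\text{and}\quad\mathcal{R}^{1/2}(\hat f_{\hat\tau})\le2\sigma(1+\sqrt\alpha)\delta_n^{1/2}+(1-\sqrt\alpha)\,\mathcal{U}^{1/2}(f^* ).$$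
   Context: Model: $Y=\langle\boldsymbol{X},\boldsymbol{\beta}^*\rangle+b^*_S+\xi$ with $\boldsymbol{\beta}^*\in\mathbb{R}^p$, $\boldsymbol{b}^*=(b^*_1,\dots,b^*_K)\in\mathbb{R}^K$, $\boldsymbol{X}\sim\mathcal{N}(\boldsymbol 0,\boldsymbol\Sigma)$ with $\boldsymbol\Sigma$ symmetric positive definite, $\boldsymbol X$ independent of $S\in[K]$, and $\xi\sim\mathcal{N}(0,\sigma^2)$ independent, $\sigma>0$ known. The regression function is $f^*(\boldsymbol x,s)=\langle\boldsymbol x,\boldsymbol\beta^*\rangle+b^*_s$. Observations: for each $s\in[K]$, $\boldsymbol Y_s=\mathbf X_s\boldsymbol\beta^*+b^*_s\boldsymbol 1_{n_s}+\boldsymbol\xi_s$, where $\mathbf X_s\in\mathbb{R}^{n_s\times p}$ has i.i.d. rows $\mathcal N(\boldsymbol0,\boldsymbol\Sigma)$, $\boldsymbol\xi_s$ has i.i.d. $\mathcal N(0,\sigma^2)$ entries, all independent; $n=n_1+\dots+n_K$ and $w_s=n_s/n$. Risk: $\mathcal R(f)=\sum_s w_s\mathbb E(\langle\boldsymbol X,\boldsymbol\beta^*\rangle+b^*_s-f(\boldsymbol X,s))^2$ with $\boldsymbol X\sim\mathcal N(\boldsymbol0,\boldsymbol\Sigma)$ independent of the sample; unfairness: $\mathcal U(f)=\min_{\nu\in\mathcal P_2(\mathbb R)}\sum_s w_s\mathsf W_2^2(\mathrm{Law}(f(\boldsymbol X,s)),\nu)$, $\boldsymbol X\sim\mathcal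 N(\boldsymbol 0,\boldsymbol\Sigma)$, $\mathsf W_2$ the Wasserstein-2 distance (both computed with the sample fixed). Least squares: $(\hat{\boldsymbol\beta},\hat{\boldsymbol b})\in\arg\min_{(\boldsymbol\beta,\boldsymbol b)\in\mathbb R^p\times\mathbb R^K}\sum_s w_s\frac{1}{n_s}\|\boldsymbol Y_s-\mathbf X_s\boldsymbol\beta-b_s\boldsymbol1_{n_s}\|_2^2$. For $\tau\in[0,1]$, $\hat f_\tau(\boldsymbol x,s)=\langle\boldsymbol x,\hat{\boldsymbol\beta}\rangle+\sqrt\tau\hat b_s+(1-\sqrt\tau)\sum_{s'}w_{s'}\hat b_{s'}$. *)

(* Defs.v *)
From HB Require Import structures.
From mathcomp Require Import all_boot all_order all_algebra.
From mathcomp Require Import all_classical all_reals all_analysis.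

Set Implicit Arguments.
Unset Strict Implicit.
Unset Printing Implicit Defensive.
Import Order.TTheory GRing.Theory Num.Theory.
Local Open Scope classical_set_scope.
Local Open Scope ring_scope.

Section Defs.
Context {R : realType}.

Definition dotv (p : nat) (x y : 'rV[R]_p) : R := \sum_(i < p) x 0 i * y 0 i.

Definition qform (p : nat) (Sigma : 'M[R]_p) (u : 'rV[R]_p) : R :=
  (u *m Sigma *m u^T) 0 0.

Definition gauss_law (m v : R) : set R -> \bar R :=
  if v == 0 then (fun A => (\1_A m)%:E) else normal_prob m (Num.sqrt v).

Definition law d (T : measurableType d) (Q : probability T R) (g : T -> R)
  : set R -> \bar R := pushforward Q g.

Definition couplings (mu nu : set R -> \bar R) : set (probability (R * R)%type R) :=
  [set pi | forall A : set R, measurable A ->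
      pi (A `*` setT) = mu A /\ pi (setT `*` A) = nu A].

Definition W2sq (mu nu : set R -> \bar R) : \bar R :=
  ereal_inf [set (\int[pi]_z ((z.1 - z.2) ^+ 2)%:E)%E | pi in couplings mu nu].

Definition P2 : set (probability R R) :=
  [set nu : probability R R | (\int[nu]_x ((x : R) ^+ 2)%:E < +oo)%E].


Definition weight (K : nat) (ns : 'I_K -> nat) (s : 'I_K) : R :=
  (ns s)%:R / (\sum_(s' < K) ns s')%:R.

(* Risk R(f) = sum_s w_s E (<X,beta*> + b*_s - f(X,s))^2, where X = Xnew
   is a N(0,Sigma) vector defined on an auxiliary probability space (T,Q),
   independent of the sample (the sample is fixed). *)
Definition risk d (T : measurableType d) (Q : probability T R) (p K : nat)
  (Xnew : T -> 'rV[R]_p) (w : 'I_K -> R) (bstar : 'rV[R]_p) (bs : 'I_K -> R)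
  (f : 'rV[R]_p -> 'I_K -> R) : \bar R :=
  (\sum_(s < K) (w s)%:E *
     \int[Q]_x ((dotv (Xnew x) bstar + bs s - f (Xnew x) s) ^+ 2)%:E)%E.

Definition unfairness d (T : measurableType d) (Q : probability T R) (p K : nat)
  (Xnew : T -> 'rV[R]_p) (w : 'I_K -> R) (f : 'rV[R]_p -> 'I_K -> R) : \bar R :=
  ereal_inf [set (\sum_(s < K) (w s)%:E *
                    W2sq (law Q (fun x => f (Xnew x) s)) nu)%E | nu in P2].

Definition f_tau (p K : nat) (w : 'I_K -> R) (tau : R) (beta : 'rV[R]_p)
  (b : 'I_K -> R) : 'rV[R]_p -> 'I_K -> R :=
  fun x s => dotv x beta + Num.sqrt tau * b s
             + (1 - Num.sqrt tau) * \sum_(s' < K) w s' * b s'.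

Definition fstar (p K : nat) (bstar : 'rV[R]_p) (bs : 'I_K -> R)
  : 'rV[R]_p -> 'I_K -> R := fun x s => dotv x bstar + bs s.

Definition ls_obj (p K : nat) (ns : 'I_K -> nat) (w : 'I_K -> R)
  (Xs : forall s : 'I_K, 'M[R]_(ns s, p)) (Ys : forall s : 'I_K, 'cV[R]_(ns s))
  (beta : 'rV[R]_p) (b : 'I_K -> R) : R :=
  \sum_(s < K) w s * ((ns s)%:R^-1 *
     \sum_(i < ns s) (Ys s i 0 - dotv (row i (Xs s)) beta - b s) ^+ 2).

Definition delta_n (n p K t : R) : R :=
  8 * (p / n + K / n)
  + 16 * (Num.sqrt (p / n) + Num.sqrt (K / n)) * Num.sqrt (t / n)
  + 32 * t / n.

Definition theta (p K t : R) : R :=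
  (4 * Num.sqrt K + 5 * Num.sqrt t + 6 * Num.sqrt p) / (Num.sqrt p + Num.sqrt t).

Definition tau_hat (alpha sigma delta sqrtU1 : R) : R :=
  if sigma * Num.sqrt delta < sqrtU1 then
    alpha * (1 + sigma * Num.sqrt delta / (sqrtU1 - sigma * Num.sqrt delta)) ^- 2
  else 0.

End Defs.

(* Main.v *)
(** The fair estimator is controlled as soon as the least-squares error
    [q(betahat - beta* ) + sum_s w_s (bhat_s - b*_s)^2] is at most
    [sigma^2 delta_n]: for a regression function [<x, beta> + c_s] the unfairness
    is the weighted variance of [c], so everything follows from Minkowski's
    inequality.

    For the error bound, normalize [Sigma = 1] and [sigma = 1], and let [A v] be the
    vector of the [<X_i, u> + b_(s_i)], [v = (u, b)].  For fixed [v] with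
    [|u|^2 <= 1/3], [E exp (<A v, xi> - |A v|^2) <= exp (- 3/8 n |v|^2)], where
    [|v|^2 = |u|^2 + sum_s w_s b_s^2].  Summing over the
    lattice [sqrt (2/n) Z^(p+K)] with Gaussian weights, together with a chi-square
    bound for the design, one exponential moment and Markov's inequality give an
    event of probability at least [1 - 2 exp (- t/2)].  If the error [v] of least
    squares were too large on this event, then rounding a shrunk copy of it,
    coordinate by coordinate, would give a lattice point violating the bound:
    the rounding costs only a quarter of the squared norms of the columns, and
    optimality gives [<A v, xi> >= |A v|^2] for the shrunk error.

    As the Gaussian hypotheses only describe the laws of linear forms, the
    exponential moments of quadratic forms are derived from those of linear
    forms: [exp (k Y^2)] is a Gaussian mixture of [exp (a Y)], and
    [exp (- k Y^2)] is a limit of polynomials in [exp (k Y^2 / N)]. *)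
Require Import Defs.
From HB Require Import structures.
From mathcomp Require Import all_boot all_order all_algebra.
From mathcomp Require Import ring lra.
From mathcomp Require Import all_classical all_reals all_analysis.
From mathcomp Require Import measurable_realfun.
Import Order.TTheory GRing.Theory Num.Theory.
Import numFieldNormedType.Exports.
Local Open Scope classical_set_scope.
Local Open Scope ring_scope.
Set Implicit Arguments.
Unset Strict Implicit.

(** * Gaussian integrals *)

(** The Radon-Nikodym derivative of the normal law agrees almost everywhere with [normal_pdf], since
    both have the same integral over every measurable set. *)
Lemma ge0_integral_normal_prob (R : realType) (m s : R) (f : R -> \bar R) :
  s != 0 -> measurable_fun setT f -> (forall x, (0 <= f x)%E) ->
  (\int[normal_prob m s]_x f x =
   \int[lebesgue_measure]_x (f x * (normal_pdf m s x)%:E))%E.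
Proof.
move=> s0 mf f0.
have nmu := @normal_prob_dominates R m s.
rewrite -(Radon_Nikodym_SigmaFinite.change_of_variables nmu)//=.
apply: ae_eq_integral => //.
- apply: emeasurable_funM => //; apply: (measurable_int lebesgue_measure).
  exact: Radon_Nikodym_SigmaFinite.f_integrable.
- apply: emeasurable_funM => //=; apply/measurableT_comp => //=.
  exact: measurable_normal_pdf.
- apply: ae_eqe_mul2l => /=; apply: integral_ae_eq => //=.
  + exact: Radon_Nikodym_SigmaFinite.f_integrable.
  + by apply/measurableT_comp => //; exact: measurable_normal_pdf.
  + by move=> E _ mE; rewrite -Radon_Nikodym_SigmaFinite.f_integral.
Qed.

(** Completing the square: tilting N(m, s^2) by a quadratic exponent gives a multiple of N((m + a
    s^2) / D, s^2 / D), and the multiple is the exponential moment. *)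
Lemma normal_pdf_tilt (R : realType) (m s a k y : R) :
  0 < s -> 0 < 1 - 2 * k * s ^+ 2 ->
  let D := 1 - 2 * k * s ^+ 2 in
  expR (a * y + k * y ^+ 2) * normal_pdf m s y =
  expR (((m + a * s ^+ 2) ^+ 2 / D - m ^+ 2) / (2 * s ^+ 2) - ln D / 2)
  * normal_pdf ((m + a * s ^+ 2) / D) (s / Num.sqrt D) y.
Proof.
move=> s0 D0 D; rewrite -/D in D0.
have r0 : 0 < Num.sqrt D by rewrite sqrtr_gt0.
have s2 : (s / Num.sqrt D) ^+ 2 = s ^+ 2 / D.
  by rewrite exprMn exprVn sqr_sqrtr// ltW.
rewrite !normal_pdfE ?gt_eqF ?divr_gt0//.
have -> : normal_peak (s / Num.sqrt D) = Num.sqrt D * normal_peak s.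
  rewrite /normal_peak s2 mulrAC -[X in Num.ExtraDef.sqrtr X]mulrnAl.
  set c := (s ^+ 2 * pi *+ 2).
  have c0 : 0 <= c by rewrite mulrn_wge0// mulr_ge0 ?sqr_ge0 ?pi_ge0.
  rewrite (sqrtrM _ c0).
  by rewrite invfM (sqrtrV (ltW D0)) invrK [LHS]mulrC.
have -> : expR (((m + a * s ^+ 2) ^+ 2 / D - m ^+ 2) / (2 * s ^+ 2) - ln D / 2) =
    (Num.sqrt D)^-1 * expR (((m + a * s ^+ 2) ^+ 2 / D - m ^+ 2) / (2 * s ^+ 2)).
  rewrite expRD mulrC; congr (_ * _).
  rewrite expRN; congr (_^-1).
  rewrite -powR12_sqrt; last exact: ltW.
  by rewrite /powR gt_eqF// mulrC.
rewrite [LHS]mulrCA [RHS]mulrACA (mulKf (lt0r_neq0 r0)).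
congr (_ * _).
rewrite /normal_fun s2 -!expRD; congr expR.
have Dn : D != 0 by rewrite gt_eqF.
have sn : s != 0 by rewrite gt_eqF.
have -> : k = (1 - D) / (2 * s ^+ 2) by rewrite /D; field.
rewrite -mulr_natr; field.
by rewrite Dn sn.
Qed.

Lemma integral_normal_prob_exp_quad (R : realType) (C m s a k : R) :
  0 < s -> 0 < 1 - 2 * k * s ^+ 2 ->
  let D := 1 - 2 * k * s ^+ 2 in
  (\int[normal_prob m s]_y (expR (C + (a * y + k * y ^+ 2)))%:E =
   (expR (C + (((m + a * s ^+ 2) ^+ 2 / D - m ^+ 2) / (2 * s ^+ 2)
               - ln D / 2)))%:E)%E.
Proof.
move=> s0 D0 D.
have mf : measurable_fun setT (fun y : R => expR (C + (a * y + k * y ^+ 2))).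
  apply: measurableT_comp => //; apply: measurable_funD => //.
  by apply: measurable_funD; apply: measurable_funM.
rewrite ge0_integral_normal_prob ?gt_eqF//; last exact/measurable_EFinP.
under eq_integral do rewrite -EFinM expRD -mulrA normal_pdf_tilt// mulrA -expRD EFinM.
rewrite integralZl//; last exact: integrable_normal_pdf.
by rewrite integral_normal_pdf mule1.
Qed.

(** * Exponential moments of squares *)

Lemma bernoulli_ineq (R : realDomainType) (z : R) n :
  0 <= z <= 1 -> 1 - n%:R * z <= (1 - z) ^+ n.
Proof.
move=> /andP[z0 z1]; elim: n => [|n ih]; first by rewrite mul0r subr0 expr0.
rewrite exprS; apply: (@le_trans _ _ ((1 - z) * (1 - n%:R * z))); last first.
  by rewrite ler_wpM2l// subr_ge0.
have := ler0n R n; rewrite -natr1; nra.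
Qed.

Lemma expR_sub1_le (R : realType) (y : R) : expR y - 1 <= y * expR y.
Proof.
have := expR_ge1Dx (- y); rewrite expRN => h.
have e0 := expR_gt0 y; have : (1 - y) * expR y <= 1.
  by rewrite -ler_pdivlMr// div1r.
lra.
Qed.

(* [(2 - e^(x/N))^N -> e^-x] gives an approximation of [e^-x] by linear
   combinations of the [e^(jx/N)], 0 <= j <= N, dominated by [e^x]. *)
Lemma cvg_two_sub_expR (R : realType) (x : R) : 0 <= x ->
  (2 - expR (x / n.+1%:R)) ^+ n.+1 @[n --> \oo] --> expR (- x).
Proof.
move=> x0; pose C := x ^+ 2 * expR x.
have e0 := expR_gt0 x.
apply: (@squeeze_cvgr _ _ _ _ (fun n => expR (- x) - C * harmonic n)
   (fun=> expR (- x))); last 2 first.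
- rewrite -[X in _ --> X]subr0 -(mulr0 C).
  by apply: cvgB; [exact: cvg_cst|apply: cvgMr; exact: cvg_harmonic].
- exact: cvg_cst.
near=> n.
have n0 : (0 : R) < n.+1%:R by rewrite ltr0n.
set y := x / n.+1%:R.
have y0 : 0 <= y by rewrite divr_ge0// ltW.
have xy : x = n.+1%:R * y by rewrite /y mulrC divfK// gt_eqF.
have yx : y <= x by rewrite /y ler_pdivrMr// ler_peMr// ler1n.
(* Eventually y e^y <= 1, which puts [z] in [0, 1], as Bernoulli's inequality requires. *)
have yey : y * expR y <= 1.
  apply: (@le_trans _ _ (y * expR x)); first by rewrite ler_wpM2l// ler_expR.
  rewrite /y mulrAC ler_pdivrMr// mul1r.
  have : x * expR x <= n%:R by near: n; exact: nbhs_infty_ger.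
  by move=> /le_trans; apply; rewrite ler_nat.
have ey1 : 1 <= expR y by rewrite -expR0 ler_expR.
have h1 := expR_sub1_le y.
set z := (expR y - 1) ^+ 2.
have z01 : 0 <= z <= 1.
  by rewrite /z sqr_ge0 expr_le1// ?subr_ge0//; lra.
(* This identity shows that 2 - e^y differs from e^-y only to second order in y. *)
have fE : 2 - expR y = expR (- y) * (1 - z).
  rewrite /z expRN; have := gt_eqF (expR_gt0 y) => /negbT ?; field.
  by [].
have -> : (2 - expR y) ^+ n.+1 = expR (- x) * (1 - z) ^+ n.+1.
  rewrite fE exprMn -expRM_natl; congr (expR _ * _).
  by rewrite mulrN -xy.
have zn : n.+1%:R * z <= x ^+ 2 * (expR x) ^+ 2 / n.+1%:R.
  rewrite ler_pdivlMr//.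
  have -> : x ^+ 2 = n.+1%:R ^+ 2 * y ^+ 2 by rewrite -exprMn -xy.
  rewrite mulrAC -expr2 -mulrA ler_wpM2l ?sqr_ge0// -exprMn /z.
  rewrite ler_sqr ?nnegrE ?subr_ge0// ?mulr_ge0// ?expR_ge0//.
  by apply: (le_trans h1); rewrite ler_wpM2l// ler_expR.
apply/andP; split; last first.
  rewrite ler_piMr ?expR_ge0// exprn_ile1//; case/andP: z01; lra.
have := bernoulli_ineq n.+1 z01.
move=> /(ler_wpM2l (expR_ge0 (- x))); apply: le_trans.
rewrite mulrBr mulr1 lerB//.
apply: (le_trans (ler_wpM2l (expR_ge0 (- x)) zn)).
rewrite expRN /C /harmonic /= le_eqVlt; apply/orP; left; apply/eqP.
move: {yey e0 fE h1 y y0 yx xy z z01 zn ey1 C} (n.+1%:R) n0 (expR x) (expR_gt0 x) => N N0 e e0.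
by field; rewrite !gt_eqF.
Unshelve. all: by end_near.
Qed.

Lemma measurable_expR_comp d (T : measurableType d) (R : realType) (f : T -> R) :
  measurable_fun setT f -> measurable_fun setT (fun x => expR (f x)).
Proof. by move=> mf; apply: measurableT_comp. Qed.

(** By the binomial formula the sum is the integral of e^G (2 - e^(X/N))^N with N = n + 1, and |2 -
    e^y| <= e^y for y >= 0 makes e^(G + X) a dominating function. Hence the integrals of e^(G + r
    X), 0 <= r <= 1, determine that of e^(G - X). *)
Lemma cvg_integral_two_sub_expR d (T : measurableType d) (R : realType)
    (mu : {measure set T -> \bar R}) (G X : T -> R) :
  measurable_fun setT G -> measurable_fun setT X -> (forall x, 0 <= X x) ->
  (\int[mu]_x (expR (G x + X x))%:E < +oo)%E ->
  (\sum_(i < n.+2) ((-1) ^+ i * 2 ^+ (n.+1 - i) *+ 'C(n.+1, i))%:E *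
     \int[mu]_x (expR (G x + i%:R / n.+1%:R * X x))%:E)%E @[n --> \oo]
  --> (\int[mu]_x (expR (G x - X x))%:E)%E.
Proof.
move=> mG mX X0 fin.
have intX : mu.-integrable setT (fun x => (expR (G x + X x))%:E).
  apply/integrableP; split.
    by apply/measurable_EFinP; apply: measurable_expR_comp; apply: measurable_funD.
  by under eq_integral do rewrite gee0_abs ?lee_fin ?expR_ge0//.
have inti n (i : 'I_n.+2) :
    mu.-integrable setT (fun x => (expR (G x + i%:R / n.+1%:R * X x))%:E).
  apply: (le_integrable _ _ _ intX) => //.
    apply/measurable_EFinP; apply: measurable_expR_comp.
    by apply: measurable_funD => //; apply: measurable_funM.
  move=> x _ /=; rewrite lee_fin !ger0_norm ?expR_ge0// ler_expR lerD2l.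
  rewrite ler_piMl// ler_pdivrMr ?ltr0n// mul1r ler_nat -ltnS.
  exact: ltn_ord.
pose f_ n x := (expR (G x) * (2 - expR (X x / n.+1%:R)) ^+ n.+1)%:E.
have f_E n x : f_ n x = (\sum_(i < n.+2)
    (((-1) ^+ i * 2 ^+ (n.+1 - i) *+ 'C(n.+1, i))%:E *
     (expR (G x + i%:R / n.+1%:R * X x))%:E))%E.
  rewrite /f_ exprBn mulr_sumr -sumEFin; apply: eq_bigr => i _.
  rewrite -EFinM; congr (_%:E).
  rewrite expRD -expRM_natl mulrnAr [RHS]mulrnAl; congr (_ *+ _).
  rewrite [X in _ = _ * (_ * expR X)](_ : _ = i%:R * (X x / n.+1%:R)); last first.
    by rewrite mulrAC -mulrA.
  by rewrite mulrCA.
rewrite [X in X @ _ --> _](_ : _ = fun n => (\int[mu]_x f_ n x)%E); last first.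
  apply/funext => n; under [RHS]eq_integral do rewrite f_E.
  rewrite integral_sum//; last by move=> i; exact: integrableZl.
  by apply: eq_bigr => i _; rewrite integralZl.
have := @dominated_convergence _ _ _ mu setT measurableT f_
  (fun x => (expR (G x - X x))%:E) (fun x => (expR (G x + X x))%:E).
case => //.
- move=> n; apply/measurable_EFinP; apply: measurable_funM.
    exact: measurable_expR_comp.
  apply: measurable_funX; apply: measurable_funB => //.
  by apply: measurable_expR_comp; apply: measurable_funM.
- apply/measurable_EFinP; apply: measurable_expR_comp.
  exact: measurable_funB.
- apply/aeW => x _; apply: cvg_EFin; first exact: nearW.
  rewrite expRD; apply: cvgMr; exact: cvg_two_sub_expR.
- apply/aeW => x n _; rewrite /f_ lee_fin normrM ger0_norm ?expR_ge0//.
  rewrite expRD ler_wpM2l ?expR_ge0// normrX.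
  set y := X x / n.+1%:R.
  have y0 : 0 <= y by rewrite divr_ge0// ltW.
  have -> : expR (X x) = expR y ^+ n.+1.
    by rewrite -expRM_natl /y mulrC divfK// pnatr_eq0.
  rewrite lerXn2r ?nnegrE ?expR_ge0//.
  have e1 : 1 <= expR y by rewrite -expR0 ler_expR.
  by rewrite ler_norml; apply/andP; split; lra.
Qed.

(* Under the measure [e^G mu], of mass [e^C], [Y] has the moment generating
   function of [N(b, s^2)]; the weight [G] makes the lemma iterable. *)
Lemma integral_exp_sqr_transfer d (T : measurableType d) (R : realType)
    (mu : probability T R) (G Y : T -> R) (C b s : R) :
  measurable_fun setT G -> measurable_fun setT Y -> 0 < s ->
  (forall a, \int[mu]_x (expR (G x + a * Y x))%:E =
             (expR (C + a * b + a ^+ 2 * s ^+ 2 / 2))%:E)%E ->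
  forall k : R, 0 <= k -> 0 < 1 - 2 * k * s ^+ 2 ->
  (\int[mu]_x (expR (G x + k * Y x ^+ 2))%:E =
   (expR (C + k * b ^+ 2 / (1 - 2 * k * s ^+ 2)
            - ln (1 - 2 * k * s ^+ 2) / 2))%:E)%E.
Proof.
move=> mG mY s0 H k k0 D0.
(* With this [c], e^(k u^2) is the mean of e^(c u y) for y standard normal; exchanging the integrals
   leaves a Gaussian integral in y. *)
pose c := Num.sqrt (2 * k).
have c2 : c ^+ 2 = 2 * k by rewrite sqr_sqrtr// mulr_ge0.
have HS (g u : R) :
    (\int[normal_prob 0 1]_y (expR (g + ((c * u) * y + 0 * y ^+ 2)))%:E =
     (expR (g + k * u ^+ 2))%:E)%E.
  rewrite integral_normal_prob_exp_quad//.
  congr (expR _)%:E; rewrite mulr0 mul0r subr0 ln1.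
  have -> : k = c ^+ 2 / 2 by rewrite c2; field.
  by field.
transitivity (\int[mu]_x \int[normal_prob 0 1]_y (expR (G x + y * c * Y x))%:E)%E.
  apply: eq_integral => x _; rewrite -HS.
  by apply: eq_integral => y _; congr (expR _)%:E; ring.
rewrite (@fubini_tonelli _ _ _ _ _ mu (normal_prob 0 1)
  (fun z : T * R => (expR (G z.1 + z.2 * c * Y z.1))%:E))/=.
- under eq_integral do rewrite H.
  transitivity (\int[normal_prob 0 1]_y
     (expR (C + ((c * b) * y + (k * s ^+ 2) * y ^+ 2)))%:E)%E.
    apply: eq_integral => y _; congr (expR _)%:E.
    by rewrite exprMn c2; field.
  have D0' : 0 < 1 - 2 * (k * s ^+ 2) * 1 ^+ 2 by rewrite expr1n mulr1 mulrA.
  rewrite integral_normal_prob_exp_quad//; congr (expR _)%:E.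
  rewrite expr1n !mulr1 add0r expr0n/= subr0 exprMn c2 mulrA.
  by field; rewrite gt_eqF.
- apply/measurable_EFinP; apply: measurable_expR_comp.
  apply: measurable_funD; first exact: measurableT_comp.
  apply: measurable_funM; first by apply: measurable_funM.
  exact: measurableT_comp.
- by move=> z; rewrite lee_fin expR_ge0.
Qed.

(** For 0 <= r <= 1 the moment of r k Y^2 equals that of N(b, s^2) with weight e^C. The
    approximating sequences at -k therefore coincide, and their limit is an explicit Gaussian
    integral. The condition on [k] makes the dominating moment finite. *)
Lemma integral_exp_Nsqr_transfer d (T : measurableType d) (R : realType)
    (mu : probability T R) (G Y : T -> R) (C b s : R) :
  measurable_fun setT G -> measurable_fun setT Y -> 0 < s ->
  (forall a, \int[mu]_x (expR (G x + a * Y x))%:E =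
             (expR (C + a * b + a ^+ 2 * s ^+ 2 / 2))%:E)%E ->
  forall k : R, 0 <= k -> 0 < 1 - 2 * k * s ^+ 2 ->
  (\int[mu]_x (expR (G x - k * Y x ^+ 2))%:E =
   (expR (C - k * b ^+ 2 / (1 + 2 * k * s ^+ 2)
            - ln (1 + 2 * k * s ^+ 2) / 2))%:E)%E.
Proof.
move=> mG mY s0 H k k0 D0.
have mY2 : measurable_fun setT (fun x => k * Y x ^+ 2).
  by apply: measurable_funM => //; exact: measurable_funX.
have D01 (r : R) : 0 <= r <= 1 -> 0 < 1 - 2 * (r * k) * s ^+ 2.
  move=> /andP[r0 r1]; apply: (lt_le_trans D0); rewrite lerD2l lerN2.
  rewrite ler_wpM2r ?sqr_ge0// ler_wpM2l//; nra.
have E (r : R) : 0 <= r <= 1 ->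
    (\int[mu]_x (expR (G x + r * (k * Y x ^+ 2)))%:E =
     \int[normal_prob b s]_y (expR (C + r * (k * y ^+ 2)))%:E)%E.
  move=> r01; have /andP[r0 _] := r01.
  under eq_integral do rewrite mulrA.
  rewrite (integral_exp_sqr_transfer mG mY s0 H) ?D01 ?mulr_ge0//.
  transitivity (\int[normal_prob b s]_y (expR (C + (0 * y + r * k * y ^+ 2)))%:E)%E.
    rewrite integral_normal_prob_exp_quad ?D01//; congr (expR _)%:E.
    rewrite mul0r addr0 addrA; congr (_ - _); congr (_ + _).
    by field; rewrite !gt_eqF ?D01.
  by apply: eq_integral => y _; rewrite mul0r add0r mulrA.
have E1 : (\int[mu]_x (expR (G x + k * Y x ^+ 2))%:E =
     \int[normal_prob b s]_y (expR (C + k * y ^+ 2))%:E)%E.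
  have := E 1; rewrite ler01 lexx => /(_ isT).
  under eq_integral do rewrite mul1r.
  by under [in RHS]eq_integral do rewrite mul1r.
have fin1 : (\int[mu]_x (expR (G x + k * Y x ^+ 2))%:E < +oo)%E.
  by rewrite (integral_exp_sqr_transfer mG mY s0 H)// ltry.
have l1 := cvg_integral_two_sub_expR mG mY2 (fun x => mulr_ge0 k0 (sqr_ge0 (Y x))) fin1.
have l2 := @cvg_integral_two_sub_expR _ _ R (normal_prob b s) (cst C) (fun y => k * y ^+ 2)
  (measurable_cst _) _ (fun y => mulr_ge0 k0 (sqr_ge0 y)).
rewrite E1 in fin1; have {}l2 := l2 _ fin1.
transitivity (\int[normal_prob b s]_y (expR (C - k * y ^+ 2))%:E)%E.
  apply: (cvg_unique (@ereal_hausdorff R) l1).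
  have mq : measurable_fun setT (fun y : R => k * y ^+ 2) by apply: measurable_funM.
  move: (l2 mq); apply: cvg_trans; apply: near_eq_cvg; apply: nearW.
  move=> n; apply: eq_bigr => i _; rewrite E//=.
  by rewrite divr_ge0//= ler_pdivrMr// mul1r ler_nat -ltnS; exact: ltn_ord.
have D0' : 0 < 1 - 2 * (- k) * s ^+ 2.
  by rewrite mulrN mulNr opprK ltr_wpDr// mulr_ge0 ?sqr_ge0// mulr_ge0.
transitivity (\int[normal_prob b s]_y (expR (C + (0 * y + (- k) * y ^+ 2)))%:E)%E.
  by apply: eq_integral => y _; rewrite mul0r add0r mulNr.
rewrite integral_normal_prob_exp_quad//; congr (expR _)%:E.
move: D0'; rewrite mulrN mulNr opprK => D0'.
rewrite mul0r addr0 addrA; congr (_ - _); congr (_ + _).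
by field; rewrite !gt_eqF.
Qed.

(** * Products of independent Gaussian factors *)

Lemma eq_integral_expR d (T : measurableType d) (R : realType)
    (mu : {measure set T -> \bar R}) (f g : T -> R) : f =1 g ->
  (\int[mu]_x (expR (f x))%:E = \int[mu]_x (expR (g x))%:E)%E.
Proof. by move=> fg; apply: eq_integral => x _; rewrite fg. Qed.

Lemma measurable_sum_cond d (T : measurableType d) (R : realType) (I : Type)
    (s : seq I) (Q : pred I) (h : I -> T -> R) :
  (forall i, measurable_fun setT (h i)) ->
  measurable_fun setT (fun x => \sum_(i <- s | Q i) h i x).
Proof.
move=> mh; under eq_fun do rewrite big_mkcond.
by apply: measurable_sum => i; case: (Q i).
Qed.

(* Each factor [e^(L i)] of the weight is replaced in turn by its image under a
   rule that only needs the exponential moments of [L i] under the remaining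
   weight; this plays the role of independence. *)
Lemma integral_exp_tensor d (T : measurableType d) (R : realType)
    (P : probability T R) (I : finType) (Th : Type) (th0 : Th)
    (L : I -> Th -> T -> R) (c : I -> Th -> R) (F : I -> T -> R) (C : I -> R) :
  (forall i th, measurable_fun setT (L i th)) ->
  (forall i, measurable_fun setT (F i)) ->
  (forall i (G : T -> R) (D : R), measurable_fun setT G ->
     (forall th, \int[P]_x (expR (G x + L i th x))%:E
                 = (expR (D + c i th))%:E)%E ->
     (\int[P]_x (expR (G x + F i x))%:E = (expR (D + C i))%:E)%E) ->
  (forall th : I -> Th, \int[P]_x (expR (\sum_i L i (th i) x))%:E
                        = (expR (\sum_i c i (th i)))%:E)%E ->
  (\int[P]_x (expR (\sum_i F i x))%:E = (expR (\sum_i C i))%:E)%E.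
Proof.
move=> mL mF step H.
(* Induction on the list [r] of indices already replaced, for all parameters [th] of the others. *)
suff Hr (r : seq I) (th : I -> Th) :
    (\int[P]_x (expR (\sum_i if i \in r then F i x else L i (th i) x))%:E
     = (expR (\sum_i if i \in r then C i else c i (th i)))%:E)%E.
  have := Hr (enum I) (fun=> th0).
  under eq_integral do under eq_bigr do rewrite mem_enum inE.
  by under [in RHS]eq_bigr do rewrite mem_enum inE.
elim: r th => [|j r ih] th; first exact: H.
have [jr|jr] := boolP (j \in r).
  have e i : (i \in j :: r) = (i \in r).
    by rewrite inE; case: eqVneq => // ->; rewrite jr.
  under eq_integral do under eq_bigr do rewrite e.
  by under [in RHS]eq_bigr do rewrite e.
under eq_integral do rewrite (bigD1 j)//= mem_head addrC.
rewrite (bigD1 j)//= mem_head [in RHS]addrC.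
apply: step.
  apply: measurable_sum_cond => i; by case: (i \in _).
(* Varying the parameter of [j] alone turns the induction hypothesis into the premise of the
   replacement rule. *)
move=> t0; pose th' i := if i == j then t0 else th i.
have eE (f : I -> R) (g' : I -> Th -> R) :
    (\sum_(i | i != j) if i \in j :: r then f i else g' i (th i)) + g' j t0 =
    \sum_i if i \in r then f i else g' i (th' i).
  rewrite [RHS](bigD1 j)//= (negbTE jr) /th' eqxx addrC; congr (_ + _).
  by apply: eq_bigr => i ij; rewrite inE (negbTE ij).
rewrite (eE C c) -ih; apply: eq_integral => x _.
by rewrite (eE (F^~ x) (fun i t => L i t x)).
Qed.

(** The exponent is x^2/4 - Y^2 with Y = a + b - x/2, where a and x behave as independent N(0, r)
    and N(0, 1) under the weight. The factor e^(x^2/4) doubles the variance of x, so Y becomes N(b,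
    r + 1/2). Then e^(-Y^2) is applied in two halves: the transfer lemma at k = 1 would ask for 1 -
    2 (r + 1/2) > 0. *)
Lemma integral_exp_mul_sub_sqr d (T : measurableType d) (R : realType)
    (P : probability T R) (G a x : T -> R) (D r b : R) :
  measurable_fun setT G -> measurable_fun setT a -> measurable_fun setT x ->
  0 <= r <= 3^-1 ->
  (forall s : R * R, \int[P]_w (expR (G w + (s.1 * a w + s.2 * x w)))%:E =
     (expR (D + (r * s.1 ^+ 2 + s.2 ^+ 2) / 2))%:E)%E ->
  (\int[P]_w (expR (G w + ((a w + b) * x w - (a w + b) ^+ 2)))%:E =
   (expR (D + (- (ln (1 + r) / 2) - b ^+ 2 / (2 * (1 + r)))))%:E)%E.
Proof.
move=> mG ma mx /andP[r0 r3] H.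
pose G2 w := G w + 4^-1 * x w ^+ 2.
pose Y w := a w + b - x w / 2.
have mx2 : measurable_fun setT (fun w => 4^-1 * x w ^+ 2).
  by apply: measurable_funM => //; exact: measurable_funX.
have mG2 : measurable_fun setT G2 by exact: measurable_funD.
have mY : measurable_fun setT Y.
  apply: measurable_funB; first exact: measurable_funD.
  exact: measurable_funM.
have mtY t : measurable_fun setT (fun w => t * Y w) by exact: measurable_funM.
pose s := Num.sqrt (r + 2^-1).
have s2 : s ^+ 2 = r + 2^-1 by rewrite sqr_sqrtr//; lra.
have s0 : 0 < s by rewrite sqrtr_gt0; lra.
(* For fixed [t] the factor e^(t Y), apart from the square, is absorbed into the weight; this gives
   [x] the mean - t/2. *)
have H2 t : (\int[P]_w (expR (G2 w + t * Y w))%:E =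
    (expR (D - ln (2^-1) / 2 + t * b + t ^+ 2 * s ^+ 2 / 2))%:E)%E.
  have mG1 : measurable_fun setT (fun w => G w + (t * a w + (- t / 2) * x w + t * b)).
    apply: measurable_funD => //; apply: measurable_funD => //.
    by apply: measurable_funD; apply: measurable_funM.
  have := @integral_exp_sqr_transfer _ _ _ P _ x
    (D + t * b + (r * t ^+ 2 + (- t / 2) ^+ 2) / 2) (- t / 2) 1 mG1 mx ltr01.
  move=> /(_ _ 4^-1) h.
  rewrite (@eq_integral_expR _ _ _ P _ (fun w =>
      G w + (t * a w + (- t / 2) * x w + t * b) + 4^-1 * x w ^+ 2)); last first.
    by move=> w; rewrite /G2 /Y; field.
  rewrite h; last 3 first.
  - move=> u; have := H (t, u - t / 2) => /= {}H.
    have mGa : measurable_fun setT (fun w => G w + (t * a w + (u - t / 2) * x w)).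
      apply: measurable_funD => //.
      by apply: measurable_funD; apply: measurable_funM.
    rewrite (@eq_integral_expR _ _ _ P _ (fun w =>
        t * b + (G w + (t * a w + (u - t / 2) * x w)))); last by move=> w; field.
    under eq_integral do rewrite expRD EFinM.
    rewrite ge0_integralZl ?lee_fin ?expR_ge0//; last first.
      exact/measurable_EFinP/measurable_expR_comp.
    rewrite H -EFinM -expRD; congr (expR _)%:E; by field.
  - lra.
  - lra.
  congr (expR _)%:E; rewrite s2 expr1n mulr1 (_ : 1 - 2 * 4^-1 = 2^-1); last by field.
  by field.
pose G3 w := G2 w - 2^-1 * Y w ^+ 2.
have mG3 : measurable_fun setT G3.
  by apply: measurable_funB => //; apply: measurable_funM => //; exact: measurable_funX.
pose q := r + 3 / 2.
have q0 : 0 < q by rewrite /q; lra.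
have qs : 1 + 2 * 2^-1 * s ^+ 2 = q by rewrite s2 /q; field.
have sq2 : (s / Num.sqrt q) ^+ 2 = (r + 2^-1) / q.
  by rewrite exprMn exprVn (sqr_sqrtr (ltW q0)) s2.
(* After the first half, Y has mean b/q and variance s^2/q with q = 1 + s^2, small enough for the
   second half. *)
have H3 t : (\int[P]_w (expR (G3 w + t * Y w))%:E =
   (expR ((D - ln (2^-1) / 2 - b ^+ 2 / (2 * q) - ln q / 2) + t * (b / q)
      + t ^+ 2 * (s / Num.sqrt q) ^+ 2 / 2))%:E)%E.
  have mG1 : measurable_fun setT (fun w => G2 w + t * Y w) by exact: measurable_funD.
  have := @integral_exp_Nsqr_transfer _ _ _ P _ Y
    (D - ln (2^-1) / 2 + t * b + t ^+ 2 * s ^+ 2 / 2) (b + t * s ^+ 2) s mG1 mY s0.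
  move=> /(_ _ 2^-1) h.
  rewrite (@eq_integral_expR _ _ _ P _ (fun w => G2 w + t * Y w - 2^-1 * Y w ^+ 2));
    last by move=> w; rewrite /G3 addrAC.
  rewrite h; last 3 first.
  - move=> u; under eq_integral do rewrite -addrA -mulrDl.
    by rewrite H2; congr (expR _)%:E; field.
  - lra.
  - rewrite s2; lra.
  congr (expR _)%:E; rewrite qs sq2 s2.
  by rewrite /q; field; lra.
have sq0 : 0 < s / Num.sqrt q by rewrite divr_gt0// sqrtr_gt0.
have := @integral_exp_Nsqr_transfer _ _ _ P _ Y _ _ _ mG3 mY sq0 H3 2^-1.
move=> h.
rewrite (@eq_integral_expR _ _ _ P _ (fun w => G3 w - 2^-1 * Y w ^+ 2)); last first.
  by move=> w; rewrite /G3 /G2 /Y; field.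
rewrite h; last 2 first.
- lra.
- rewrite sq2 divff ?pnatr_eq0// mul1r subr_gt0 ltr_pdivrMr// mul1r /q; lra.
congr (expR _)%:E; rewrite sq2.
have lnE : ln (1 + 2 * 2^-1 * ((r + 2^-1) / q)) = ln 2 + ln (1 + r) - ln q.
  rewrite -lnM ?posrE; [|lra|lra].
  rewrite -ln_div ?posrE; [|lra|lra].
  by congr ln; rewrite /q; field; lra.
rewrite lnE lnV ?posrE//.
by rewrite /q; field; rewrite /q in q0 *; lra.
Qed.

Lemma integral_exp_gauss_law d (T : measurableType d) (R : realType)
    (P : probability T R) (Y : T -> R) (v : R) :
  measurable_fun setT Y -> 0 <= v ->
  (forall B : set R, measurable B -> law P Y B = gauss_law 0 v B) ->
  (\int[P]_x (expR (Y x))%:E = (expR (v / 2))%:E)%E.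
Proof.
move=> mY v0 H.
pose Y' : T -> measurableTypeR R := Y.
have mY' : measurable_fun setT Y' by exact: mY.
have -> : (\int[P]_x (expR (Y x))%:E = \int[pushforward P Y']_y (expR (y : R))%:E)%E.
  by rewrite ge0_integral_pushforward//; exact/measurable_EFinP.
have [v_eq0|vn0] := eqVneq v 0.
  transitivity (\int[dirac (0%R : measurableTypeR R)]_y (expR (y : R))%:E)%E.
    apply: eq_measure_integral => A mA _; apply: (etrans (H A mA)).
    by rewrite /gauss_law v_eq0 eqxx.
  rewrite integral_dirac//; last exact/measurable_EFinP.
  by rewrite diracT mul1e v_eq0 mul0r.
transitivity (\int[normal_prob 0 (Num.sqrt v)]_y (expR y)%:E)%E.
  apply: eq_measure_integral => A mA _; apply: (etrans (H A mA)).
  by rewrite /gauss_law (negbTE vn0).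
have sv : 0 < Num.sqrt v by rewrite sqrtr_gt0 lt_neqAle eq_sym vn0.
have := @integral_normal_prob_exp_quad R 0 0 (Num.sqrt v) 1 0 sv.
rewrite /= mulr0 mul0r subr0 => /(_ ltr01).
rewrite ln1 mul0r subr0 mul1r divr1 !add0r expr0n/= subr0 sqr_sqrtr//.
under eq_integral do rewrite mul1r mul0r add0r addr0.
by move=> ->; congr (expR _)%:E; field.
Qed.

(** A standard normal g has E exp (g^2/4) = (1 - 1/2)^(-1/2) = sqrt 2; the coordinates are treated
    one at a time. *)
Lemma integral_exp_chi2 d (T : measurableType d) (R : realType)
    (P : probability T R) (J : finType) (g : J -> T -> R) :
  (forall j, measurable_fun setT (g j)) ->
  (forall a : J -> R, \int[P]_x (expR (\sum_j a j * g j x))%:E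
     = (expR (\sum_j (a j) ^+ 2 / 2))%:E)%E ->
  (\int[P]_x (expR (\sum_j 4^-1 * g j x ^+ 2))%:E
   = (expR (\sum_(j : J) ln 2 / 2))%:E)%E.
Proof.
move=> mg H.
apply: (@integral_exp_tensor _ _ _ _ _ R 0 (fun j a x => a * g j x)
  (fun j a => a ^+ 2 / 2)) => //.
- by move=> j a; apply: measurable_funM.
- by move=> j; apply: measurable_funM => //; exact: measurable_funX.
- move=> j G D mG h.
  rewrite (@integral_exp_sqr_transfer _ _ _ _ G (g j) D 0 1)//; last 2 first.
  + by move=> a; rewrite h; congr (expR _)%:E; rewrite expr1n mulr1 mulr0 addr0.
  + by rewrite expr1n; lra.
  congr (expR _)%:E; rewrite expr1n mulr1 (_ : 1 - 2 * 4^-1 = 2^-1); last by field.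
  by rewrite lnV ?posrE//; field.
Qed.

(** From e^y <= 1/(1 - y) at y = 3r/4, because (1 - 3r/4)(1 + r) = 1 + r (1 - 3r)/4 >= 1 for r <=
    1/3. *)
Lemma ln1D_ge (R : realType) (r : R) : 0 <= r <= 3^-1 -> 3 / 4 * r <= ln (1 + r).
Proof.
move=> /andP[r0 r3]; rewrite -ler_expR lnK ?posrE; last by lra.
have := expR_ge1Dx (- (3 / 4 * r)); rewrite expRN.
set E := expR _; have E0 : 0 < E by exact: expR_gt0.
move=> h; have {}h : (1 - 3 / 4 * r) * E <= 1 by rewrite -ler_pdivlMr// div1r.
rewrite -(ler_pM2l (_ : 0 < 1 - 3 / 4 * r)); last by lra.
by apply: (le_trans h); nra.
Qed.

(** Each index contributes the factor (1 + r)^(-1/2) exp (- b_i^2 / (2 (1 + r))); for r <= 1/3 the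
    constant 3/8 serves for both exponents. *)
Lemma integral_exp_cross_term_le d (T : measurableType d) (R : realType)
    (P : probability T R) (I : finType) (a x : I -> T -> R) (r : R) (b : I -> R) :
  (forall i, measurable_fun setT (a i)) -> (forall i, measurable_fun setT (x i)) ->
  0 <= r <= 3^-1 ->
  (forall s : I -> R * R,
     \int[P]_w (expR (\sum_i ((s i).1 * a i w + (s i).2 * x i w)))%:E
     = (expR (\sum_i (r * (s i).1 ^+ 2 + (s i).2 ^+ 2) / 2))%:E)%E ->
  (\int[P]_w (expR (\sum_i ((a i w + b i) * x i w - (a i w + b i) ^+ 2)))%:E
   <= (expR (- (3 / 8 * \sum_i (r + b i ^+ 2))))%:E)%E.
Proof.
move=> ma mx r01 H.
rewrite (@integral_exp_tensor _ _ _ _ _ (R * R)%type (0, 0)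
  (fun i s w => s.1 * a i w + s.2 * x i w)
  (fun i s => (r * s.1 ^+ 2 + s.2 ^+ 2) / 2) _
  (fun i => - (ln (1 + r) / 2) - b i ^+ 2 / (2 * (1 + r))))//.
- rewrite lee_fin ler_expR mulr_sumr -sumrN; apply: ler_sum => i _.
  have := ln1D_ge r01; have /andP[r0 r3] := r01.
  have : 3 / 8 * b i ^+ 2 <= b i ^+ 2 / (2 * (1 + r)).
    rewrite ler_pdivlMr; last by lra.
    have := sqr_ge0 (b i); nra.
  by rewrite expr2; lra.
- by move=> i s; apply: measurable_funD; apply: measurable_funM.
- move=> i; apply: measurable_funB; last by apply: measurable_funX; exact: measurable_funD.
  by apply: measurable_funM => //; exact: measurable_funD.
- move=> i G D mG h; exact: integral_exp_mul_sub_sqr.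
Qed.

(** * Unfairness and risk *)

Lemma pushforward_probability d d' (T : measurableType d) (T' : measurableType d')
    (R : realType) (P : probability T R) (f : T -> T') :
  measurable_fun setT f ->
  exists pi : probability T' R, forall A, pi A = P (f @^-1` A).
Proof.
move=> mf; pose g : {mfun T >-> T'} := HB.pack f (isMeasurableFun.Build _ _ _ _ f mf).
by exists (distribution P g).
Qed.

Lemma le_of_forall_small_factor (R : realType) (S A B : R) : 0 <= S -> 0 <= B ->
  (forall k, 0 < k -> 0 < 1 - k * B -> S * (1 - k * B) <= A) -> S <= A.
Proof.
move=> S0 B0 H; apply/ler_addgt0Pr => e e0.
pose k := Num.min (e / (S + 1) / (B + 1)) (2^-1 / (B + 1)).
have B1 : 0 < B + 1 by lra.
have S1 : 0 < S + 1 by lra.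
have k0 : 0 < k by rewrite lt_min !divr_gt0.
have kB2 : k * (B + 1) <= 2^-1.
  by rewrite -ler_pdivlMr// ge_min lexx orbT.
have kBe : k * (B + 1) <= e / (S + 1).
  by rewrite -ler_pdivlMr// ge_min lexx.
have kB0 : 0 <= k * B by rewrite mulr_ge0// ltW.
have kBk : k * B + k <= 2^-1 by rewrite -[X in _ + X]mulr1 -mulrDr.
have := H k k0; rewrite subr_gt0 (_ : k * B < 1); last by lra.
move=> /(_ isT); rewrite mulrBr mulr1 lerBlDr => /le_trans; apply.
rewrite lerD2l; apply: (@le_trans _ _ ((S + 1) * (e / (S + 1)))).
  apply: ler_pM => //; first by lra.
  apply: le_trans kBe; rewrite ler_wpM2l ?ltW//; lra.
by rewrite mulrC divfK// gt_eqF.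
Qed.

(** A first-order bound in k for E exp (k Y^2) - 1, Y ~ N(c, v). The two factors are controlled by
    e^x <= 1/(1 - x) and D^(-1/2) <= (1 + 1/D)/2. *)
Lemma exp_gaussian_sqr_le (R : realType) (k v c : R) : 0 <= v -> 0 <= k ->
  0 < 1 - k * (2 * v + c ^+ 2) ->
  expR (k * c ^+ 2 / (1 - 2 * k * v) - ln (1 - 2 * k * v) / 2) - 1 <=
  k * (v + c ^+ 2) / (1 - k * (2 * v + c ^+ 2)).
Proof.
move=> v0 k0; set E := 1 - k * _ => E0.
set D := 1 - 2 * k * v.
have kc : 0 <= k * c ^+ 2 by rewrite mulr_ge0// sqr_ge0.
have DE : D - k * c ^+ 2 = E by rewrite /D /E; ring.
have D0 : 0 < D by lra.
have h1 : expR (k * c ^+ 2 / D) <= D / E.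
  have := expR_ge1Dx (- (k * c ^+ 2 / D)); rewrite expRN => h.
  have {}h : (1 - k * c ^+ 2 / D) * expR (k * c ^+ 2 / D) <= 1.
    by rewrite -ler_pdivlMr ?expR_gt0// div1r.
  rewrite ler_pdivlMr// -DE [leLHS]mulrC.
  have -> : D - k * c ^+ 2 = D * (1 - k * c ^+ 2 / D).
    by field; rewrite gt_eqF.
  by rewrite -[leLHS]mulrA; apply: (le_trans (ler_wpM2l (ltW D0) h)); rewrite mulr1.
have h2 : expR (- (ln D / 2)) <= (D + k * v) / D.
  have e0 := expR_gt0 (- (ln D / 2)).
  have e2 : expR (- (ln D / 2)) ^+ 2 = D^-1.
    by rewrite expr2 -expRD -[in RHS](@lnK _ D)// -expRN; congr expR; field.
  have : 2 * expR (- (ln D / 2)) <= 1 + D^-1.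
    have := sqr_ge0 (expR (- (ln D / 2)) - 1); rewrite -e2; nra.
  have -> : (D + k * v) / D = (1 + D^-1) / 2.
    have -> : k * v = (1 - D) / 2 by rewrite /D; field.
    by field; rewrite gt_eqF.
  lra.
rewrite expRD lerBlDr; apply: (@le_trans _ _ (D / E * ((D + k * v) / D))).
  by apply: ler_pM; rewrite ?expR_ge0.
rewrite le_eqVlt; apply/orP; left; apply/eqP.
have -> : D = E + k * c ^+ 2 by rewrite -DE; ring.
have -> : k * (v + c ^+ 2) = k * v + k * c ^+ 2 by ring.
field; rewrite gt_eqF//=; lra.
Qed.

(** Integrate k Y^2 <= e^(k Y^2) - 1, divide by k and let k tend to 0. *)
Lemma gaussian_second_moment_le d (T : measurableType d) (R : realType)
    (P : probability T R) (Y : T -> R) (c s : R) : measurable_fun setT Y -> 0 < s ->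
  (forall a, \int[P]_x (expR (a * Y x))%:E =
             (expR (a * c + a ^+ 2 * s ^+ 2 / 2))%:E)%E ->
  (\int[P]_x (Y x ^+ 2)%:E <= (s ^+ 2 + c ^+ 2)%:E)%E.
Proof.
move=> mY s0 H.
have mY2 : measurable_fun setT (fun x => Y x ^+ 2) by exact: measurable_funX.
have s2 : 0 <= s ^+ 2 by exact: sqr_ge0.
have c2 : 0 <= c ^+ 2 by exact: sqr_ge0.
have key k : 0 < k -> 0 < 1 - k * (2 * s ^+ 2 + c ^+ 2) ->
    (k%:E * \int[P]_x (Y x ^+ 2)%:E <=
     (k * (s ^+ 2 + c ^+ 2) / (1 - k * (2 * s ^+ 2 + c ^+ 2)))%:E)%E.
  move=> k0 E0.
  have D0 : 0 < 1 - 2 * k * s ^+ 2.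
    by apply: (lt_le_trans E0); rewrite lerD2l lerN2; have := mulr_ge0 (ltW k0) c2; lra.
  have h := exp_gaussian_sqr_le s2 (ltW k0) E0.
  have := @integral_exp_sqr_transfer _ _ _ P (cst 0) Y 0 c s (measurable_cst _) mY s0.
  move=> /(_ _ k (ltW k0) D0) T1.
  rewrite -lee_fin in h; apply: le_trans h.
  rewrite EFinB leeBrDr//.
  have -> : (k%:E * \int[P]_x (Y x ^+ 2)%:E + 1 =
             \int[P]_x (k * Y x ^+ 2 + 1)%:E)%E.
    under [RHS]eq_integral do rewrite EFinD EFinM.
    rewrite ge0_integralD//=; last 2 first.
    - by move=> x _; rewrite -EFinM lee_fin mulr_ge0 ?sqr_ge0// ltW.
    - by apply/measurable_EFinP; exact: measurable_funM.
    rewrite ge0_integralZl ?lee_fin ?(ltW k0)//.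
    - by congr (_ + _)%E; rewrite integral_cst//= mul1e; exact/esym/probability_setT.
    - exact/measurable_EFinP.
    - by move=> x _; rewrite lee_fin sqr_ge0.
  have -> : expR (k * c ^+ 2 / (1 - 2 * k * s ^+ 2) - ln (1 - 2 * k * s ^+ 2) / 2)
     = expR (0 + k * c ^+ 2 / (1 - 2 * k * s ^+ 2) - ln (1 - 2 * k * s ^+ 2) / 2).
    by rewrite add0r.
  rewrite -T1; last first.
    by move=> a; under eq_integral do rewrite add0r; rewrite H add0r.
  apply: ge0_le_integral => //.
  - by move=> x _; rewrite lee_fin addr_ge0// mulr_ge0 ?sqr_ge0// ltW.
  - apply/measurable_EFinP; apply: measurable_funD => //; exact: measurable_funM.
  - apply/measurable_EFinP; apply: measurable_expR_comp.
    by apply: measurable_funD => //; exact: measurable_funM.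
  - move=> x _; rewrite lee_fin /= add0r addrC; exact: expR_ge1Dx.
have I0 : (0 <= \int[P]_x (Y x ^+ 2)%:E)%E.
  by apply: integral_ge0 => x _; rewrite lee_fin sqr_ge0.
have B0 : 0 <= 2 * s ^+ 2 + c ^+ 2 by lra.
have Ifin : (\int[P]_x (Y x ^+ 2)%:E < +oo)%E.
  (* One admissible [k] suffices for finiteness; this one makes k (2 s^2 + c^2) < 1/2. *)
  pose k := (2 * (2 * s ^+ 2 + c ^+ 2 + 1))^-1.
  have k0 : 0 < k by rewrite invr_gt0; lra.
  have kB : 0 < 1 - k * (2 * s ^+ 2 + c ^+ 2).
    by rewrite subr_gt0 mulrC ltr_pdivrMr; lra.
  have := key k k0 kB; case: (\int[P]_x _)%E => [r||]//; first by rewrite ltry.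
  by rewrite mulry gtr0_sg// mul1e leye_eq.
have Ifn : (\int[P]_x (Y x ^+ 2)%:E \is a fin_num)%E by rewrite ge0_fin_numE.
rewrite -(fineK Ifn) lee_fin.
apply: (@le_of_forall_small_factor _ _ _ (2 * s ^+ 2 + c ^+ 2)) => //.
  exact: fine_ge0.
move=> k k0 kB; have := key k k0 kB; rewrite -(fineK Ifn) -EFinM lee_fin.
rewrite ler_pdivlMr// -mulrA ler_pM2l//.
Qed.

(** * Couplings and the Wasserstein distance *)

Lemma integrable_of_same_law d1 d2 (T1 : measurableType d1) (T2 : measurableType d2)
    (R : realType) (P1 : probability T1 R) (P2 : probability T2 R)
    (h1 : T1 -> R) (h2 : T2 -> R) :
  measurable_fun setT h1 -> measurable_fun setT h2 ->
  (forall A : set R, measurable A -> P1 (h1 @^-1` A) = P2 (h2 @^-1` A)) ->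
  P2.-integrable setT (EFin \o h2) ->
  P1.-integrable setT (EFin \o h1) /\
  (\int[P1]_x (h1 x)%:E = \int[P2]_x (h2 x)%:E)%E.
Proof.
move=> m1 m2 H i2.
have mid : measurable_fun setT (fun y : R => y%:E) by apply/measurable_EFinP.
have ma : measurable_fun setT (fun y : R => `|y%:E|%E) by exact: measurableT_comp.
have i1 : P1.-integrable setT (EFin \o h1).
  apply/integrableP; split; first exact/measurable_EFinP.
  have -> : (\int[P1]_x `|(EFin \o h1) x| = \int[P2]_x `|(EFin \o h2) x|)%E.
    rewrite -(ge0_integral_pushforward m1 _ measurableT ma)//.
    rewrite -(ge0_integral_pushforward m2 _ measurableT ma)//.
    by apply: eq_measure_integral => A mA _; exact: H.
  by case/integrableP : i2.
split => //.
transitivity (\int[pushforward P1 h1]_y y%:E)%E.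
  by rewrite (integral_pushforward m1 mid).
transitivity (\int[pushforward P2 h2]_y y%:E)%E.
  by apply: eq_measure_integral => A mA _; exact: H.
by rewrite (integral_pushforward m2 mid).
Qed.

Lemma integrable_of_sqr d (T : measurableType d) (R : realType)
    (P : probability T R) (Z : T -> R) : measurable_fun setT Z ->
  (\int[P]_x (Z x ^+ 2)%:E < +oo)%E -> P.-integrable setT (EFin \o Z).
Proof.
move=> mZ fin.
have mZ2 : measurable_fun setT (fun x => Z x ^+ 2) by exact: measurable_funX.
have i2 : P.-integrable setT (fun x => (Z x ^+ 2)%:E).
  apply/integrableP; split; first exact/measurable_EFinP.
  by under eq_integral do rewrite gee0_abs ?lee_fin ?sqr_ge0//.
have i3 : P.-integrable setT (fun x => (Z x ^+ 2)%:E + (cst 1%:E) x)%E.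
  by apply: integrableD => //; exact: finite_measure_integrable_cst.
apply: (le_integrable _ _ _ i3) => //; first exact/measurable_EFinP.
move=> x _ /=; rewrite lee_fin [leRHS]ger0_norm; last by rewrite addr_ge0 ?sqr_ge0.
rewrite ler_norml; have := sqr_ge0 (Z x - 1); have := sqr_ge0 (Z x + 1).
by move=> *; apply/andP; split; nra.
Qed.

(** Integrate the tangent inequality z^2 >= 2 m z - m^2. *)
Lemma sqr_integral_le d (T : measurableType d) (R : realType)
    (P : probability T R) (Z : T -> R) (m : R) : measurable_fun setT Z ->
  P.-integrable setT (EFin \o Z) -> (\int[P]_x (Z x)%:E = m%:E)%E ->
  ((m ^+ 2)%:E <= \int[P]_x (Z x ^+ 2)%:E)%E.
Proof.
move=> mZ iZ EZ.
have mZ2 : measurable_fun setT (fun x => (Z x ^+ 2)%:E).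
  by apply/measurable_EFinP; exact: measurable_funX.
have [fin|] := ltP (\int[P]_x (Z x ^+ 2)%:E)%E +oo%E; last first.
  by apply: le_trans; exact: leey.
have i2 : P.-integrable setT (fun x => (Z x ^+ 2)%:E).
  apply/integrableP; split => //.
  by under eq_integral do rewrite gee0_abs ?lee_fin ?sqr_ge0//.
have ic : P.-integrable setT (fun x : T => (- m ^+ 2)%:E).
  exact: finite_measure_integrable_cst.
have il : P.-integrable setT (fun x => (2 * m)%:E * (Z x)%:E)%E.
  exact: integrableZl.
have -> : ((m ^+ 2)%:E = \int[P]_x ((2 * m)%:E * (Z x)%:E + (- m ^+ 2)%:E))%E.
  rewrite integralD// integralZl// EZ integral_cst//=.
  have -> : P setT = 1%E by exact: probability_setT.
  by rewrite mule1 -EFinM -EFinD; congr _%:E; ring.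
apply: le_integral => //; first exact: integrableD.
move=> x _; rewrite -EFinM -EFinD lee_fin.
by have := sqr_ge0 (Z x - m); nra.
Qed.

(** Under every coupling the difference of the coordinates has mean a - m, so its second moment is
    at least (a - m)^2. *)
Lemma W2sq_ge_sqr_mean d (T : measurableType d) (R : realType)
    (Q : probability T R) (g : T -> R) (nu : probability R R) (a m : R) :
  measurable_fun setT g -> Q.-integrable setT (EFin \o g) ->
  (\int[Q]_x (g x)%:E = a%:E)%E ->
  nu.-integrable setT (fun y : R => y%:E) -> (\int[nu]_y y%:E = m%:E)%E ->
  (((a - m) ^+ 2)%:E <= W2sq (law Q g) nu)%E.
Proof.
move=> mg ig Eg inu Enu; apply/ereal_infP => _ [pi /= cpi <-].
have [i1 E1] : pi.-integrable setT (EFin \o fst) /\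
    (\int[pi]_z (z.1)%:E = \int[Q]_x (g x)%:E)%E.
  apply: integrable_of_same_law => // A mA.
  by apply: (etrans _ (cpi A mA).1); congr (pi _); apply/seteqP; split => [z//|z []].
have [i2 E2] : pi.-integrable setT (EFin \o snd) /\
    (\int[pi]_z (z.2)%:E = \int[nu]_y y%:E)%E.
  apply: (@integrable_of_same_law _ _ _ _ R pi nu snd id) => // A mA.
  by apply: (etrans _ (cpi A mA).2); congr (pi _); apply/seteqP; split => [z//|z []].
apply: (@sqr_integral_le _ _ _ pi (fun z => z.1 - z.2)).
- exact: measurable_funB.
- rewrite (_ : _ \o _ = (EFin \o fst) \- (EFin \o snd))%E//; exact: integrableB.
- under eq_integral do rewrite EFinB.
  by rewrite integralB// E1 E2 Eg Enu.
Qed.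

(** The coupling (g + c1, g + c2) has a constant difference. *)
Lemma W2sq_translation_le d (T : measurableType d) (R : realType)
    (Q : probability T R) (g : T -> R) (nu : probability R R) (c1 c2 : R) :
  measurable_fun setT g ->
  (forall A : set R, measurable A -> nu A = law Q (fun x => g x + c2) A) ->
  (W2sq (law Q (fun x => (g x + c1)%R)) nu <= ((c1 - c2) ^+ 2)%:E)%E.
Proof.
move=> mg nuE.
pose F x := (g x + c1, g x + c2).
have mF : measurable_fun setT F.
  by apply: measurable_fun_pair; exact: measurable_funD.
have [pi piE] := pushforward_probability Q mF.
apply: ereal_inf_lbound; exists pi => /=.
  by move=> A mA; rewrite !piE nuE//; split; congr (Q _);
    apply/seteqP; split => x //=; [case|case].
transitivity (\int[pushforward Q F]_z ((z.1 - z.2) ^+ 2)%:E)%E.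
  by apply: eq_measure_integral => A mA _; exact: piE.
have mC : measurable_fun setT (fun z : R * R => ((z.1 - z.2) ^+ 2)%:E).
  by apply/measurable_EFinP; apply: measurable_funX; exact: measurable_funB.
rewrite (ge0_integral_pushforward mF _ measurableT mC); last first.
  by move=> z _; rewrite lee_fin sqr_ge0.
transitivity (\int[Q]_x ((c1 - c2) ^+ 2)%:E)%E.
  by apply: eq_integral => x _ /=; congr _%:E; ring.
rewrite integral_cst//=; have -> : Q setT = 1%E by exact: probability_setT.
by rewrite mule1.
Qed.

(** * Unfairness as a weighted variance *)

Definition wvar {R : realType} (K : nat) (w c : 'I_K -> R) : R :=
  \sum_(s < K) w s * (c s - \sum_(s' < K) w s' * c s') ^+ 2.

Lemma wvar_le (R : realType) (K : nat) (w c : 'I_K -> R) (m : R) :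
  \sum_(s < K) w s = 1 -> wvar w c <= \sum_(s < K) w s * (c s - m) ^+ 2.
Proof.
move=> w1; rewrite /wvar; set cb := \sum_(s' < K) w s' * c s'.
have -> : \sum_(s < K) w s * (c s - m) ^+ 2 =
    \sum_(s < K) w s * (c s - cb) ^+ 2 + (cb - m) ^+ 2.
  transitivity (\sum_(s < K) (w s * (c s - cb) ^+ 2 + ((2 * (cb - m)) * (w s * c s)
      + w s * ((cb - m) ^+ 2 - 2 * (cb - m) * cb)))).
    apply: eq_bigr => s _; ring.
  rewrite !big_split/= -mulr_sumr -/cb -mulr_suml w1; congr (_ + _); ring.
by rewrite lerDl sqr_ge0.
Qed.

(** The group laws are translates of one law. The law of Y + cb, cb the weighted mean of c, attains
    the cost [wvar w c]; conversely, the means alone force at least the weighted second moment of c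
    about a constant, hence at least the variance. *)
Lemma unfairness_translates d (T : measurableType d) (R : realType)
    (Q : probability T R) (p K : nat) (Xnew : T -> 'rV[R]_p) (w : 'I_K -> R)
    (f : 'rV[R]_p -> 'I_K -> R) (Y : T -> R) (c : 'I_K -> R) :
  (forall s, 0 <= w s) -> \sum_(s < K) w s = 1 ->
  measurable_fun setT Y ->
  (forall a, \int[Q]_x ((Y x + a) ^+ 2)%:E < +oo)%E ->
  (forall x s, f (Xnew x) s = Y x + c s) ->
  unfairness Q Xnew w f = (wvar w c)%:E.
Proof.
move=> w0 w1 mY fin fE; pose cb := \sum_(s < K) w s * c s.
have mYa a : measurable_fun setT (fun x => Y x + a) by exact: measurable_funD.
have fs s : (fun x => f (Xnew x) s) = (fun x => Y x + c s).
  by apply/funext => x.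
have iY a : Q.-integrable setT (EFin \o (fun x => Y x + a)).
  exact: integrable_of_sqr.
have [nu nuE] := pushforward_probability Q (mYa cb).
have [m EY] : exists m, (\int[Q]_x (Y x)%:E = m%:E)%E.
  have := iY 0; rewrite (_ : _ \o _ = EFin \o Y); last first.
    by apply/funext => x /=; rewrite addr0.
  move=> /integrable_fin_num h; exists (fine (\int[Q]_x (Y x)%:E)%E).
  by rewrite fineK//; exact: h.
have EYa a : (\int[Q]_x (Y x + a)%:E = (m + a)%:E)%E.
  under eq_integral do rewrite EFinD.
  rewrite integralD//; last 2 first.
  - have := iY 0; apply: eq_integrable => // x _ /=; by rewrite addr0.
  - exact: finite_measure_integrable_cst.
  rewrite EY integral_cst//=; have -> : Q setT = 1%E by exact: probability_setT.
  by rewrite mule1.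
apply/eqP; rewrite eq_le; apply/andP; split.
- apply: (@le_trans _ _ (\sum_(s < K) (w s)%:E *
      W2sq (law Q (fun x => f (Xnew x) s)) nu)%E).
    apply: ereal_inf_lbound; exists nu => //.
    rewrite /P2 /= .
    rewrite (@eq_measure_integral _ _ _ _ (pushforward Q (fun x => Y x + cb))); last first.
      by move=> A mA _; exact: nuE.
    have mC : measurable_fun setT (fun y : R => (y ^+ 2)%:E).
      by apply/measurable_EFinP; exact: measurable_funX.
    rewrite (ge0_integral_pushforward (mYa cb) _ measurableT mC); last first.
      by move=> z _; rewrite lee_fin sqr_ge0.
    exact: fin.
  rewrite /wvar -sumEFin; apply: lee_sum => s _; rewrite EFinM lee_wpmul2l ?lee_fin//.
  by rewrite fs; apply: W2sq_translation_le.
- apply/ereal_infP => _ [nu' P2nu <-].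
  have inu : nu'.-integrable setT (fun y : R => y%:E).
    exact: (@integrable_of_sqr _ _ _ nu' id).
  have [m' Enu] : exists m, (\int[nu']_y y%:E = m%:E)%E.
    exists (fine (\int[nu']_y y%:E)%E); rewrite fineK//.
    by have := integrable_fin_num measurableT inu.
  apply: (@le_trans _ _ (\sum_(s < K) (w s)%:E * ((m + c s - m') ^+ 2)%:E)%E).
    under eq_bigr do rewrite -EFinM.
    rewrite sumEFin lee_fin; apply: le_trans (wvar_le c (m' - m) w1) _.
    rewrite le_eqVlt; apply/orP; left; apply/eqP.
    by apply: eq_bigr => s _; congr (_ * _ ^+ 2); ring.
  apply: lee_sum => s _; rewrite lee_wpmul2l ?lee_fin//.
  by rewrite fs; apply: W2sq_ge_sqr_mean => //.
Qed.

(** * Linear forms and the risk *)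

Lemma dotvC (R : realType) (p : nat) (x y : 'rV[R]_p) : dotv x y = dotv y x.
Proof. by apply: eq_bigr => i _; rewrite mulrC. Qed.

Lemma dotvZl (R : realType) (p : nat) (a : R) (x y : 'rV[R]_p) :
  dotv (a *: x) y = a * dotv x y.
Proof. by rewrite /dotv mulr_sumr; apply: eq_bigr => i _; rewrite mxE mulrA. Qed.

Lemma dotvDZr (R : realType) (p : nat) (a : R) (x y z : 'rV[R]_p) :
  dotv x (y + a *: z) = dotv x y + a * dotv x z.
Proof.
rewrite /dotv mulr_sumr -big_split/=; apply: eq_bigr => i _; rewrite !mxE; ring.
Qed.

Lemma dotvBr (R : realType) (p : nat) (x y z : 'rV[R]_p) :
  dotv x (y - z) = dotv x y - dotv x z.
Proof. by rewrite /dotv -sumrB; apply: eq_bigr => i _; rewrite !mxE mulrBr. Qed.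

Lemma qformZ (R : realType) (p : nat) (S : 'M[R]_p) (a : R) (u : 'rV[R]_p) :
  qform S (a *: u) = a ^+ 2 * qform S u.
Proof. by rewrite /qform linearZ/= -!scalemxAl -scalemxAr !mxE mulrA expr2. Qed.

Lemma measurable_dotv d (T : measurableType d) (R : realType) (p : nat)
    (X : T -> 'rV[R]_p) (u : 'rV[R]_p) :
  (forall j, measurable_fun setT (fun x => X x 0 j)) ->
  measurable_fun setT (fun x => dotv (X x) u).
Proof.
move=> mX; apply: measurable_sum => j.
exact: measurable_funM.
Qed.

Lemma gaussian_vector_second_moment_le d (T : measurableType d) (R : realType)
    (Q : probability T R) (p : nat) (S : 'M[R]_p) (X : T -> 'rV[R]_p)
    (u : 'rV[R]_p) (a : R) :
  (forall v : 'rV[R]_p, v != 0 -> 0 < qform S v) ->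
  (forall j, measurable_fun setT (fun x => X x 0 j)) ->
  (forall (v : 'rV[R]_p) (A : set R), measurable A ->
     law Q (fun x => dotv v (X x)) A = gauss_law 0 (qform S v) A) ->
  (\int[Q]_x ((dotv (X x) u + a) ^+ 2)%:E <= (qform S u + a ^+ 2)%:E)%E.
Proof.
move=> S0 mX H; have [u0|un0] := eqVneq u 0.
  have d0 y : dotv y (0 : 'rV[R]_p) = 0 by rewrite /dotv big1// => i _; rewrite mxE mulr0.
  rewrite u0 (_ : qform S 0 = 0); last by rewrite /qform !mul0mx mxE.
  under eq_integral do rewrite d0 add0r.
  rewrite integral_cst//= add0r; have -> : Q setT = 1%E by exact: probability_setT.
  by rewrite mule1.
have q0 := S0 u un0.
have mY := measurable_dotv u mX.
have := @gaussian_second_moment_le _ _ _ Q (fun x => dotv (X x) u + a) a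
  (Num.sqrt (qform S u)) (measurable_funD mY (measurable_cst a)).
rewrite sqrtr_gt0 (sqr_sqrtr (ltW q0)) => /(_ q0) h; apply: h => t.
have mtY : measurable_fun setT (fun x => dotv (t *: u) (X x)).
  by under eq_fun do rewrite dotvC; exact: measurable_dotv.
rewrite (@eq_integral_expR _ _ _ Q _ (fun x => t * a + dotv (t *: u) (X x))); last first.
  by move=> x; rewrite dotvZl dotvC mulrDr addrC.
under eq_integral do rewrite expRD EFinM.
rewrite ge0_integralZl ?lee_fin ?expR_ge0//; last first.
  exact/measurable_EFinP/measurable_expR_comp.
rewrite (@integral_exp_gauss_law _ _ _ _ _ (t ^+ 2 * qform S u))//; last 2 first.
- by rewrite mulr_ge0 ?sqr_ge0// ltW.
- by move=> B mB; rewrite -qformZ; exact: H.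
by rewrite -EFinM -expRD.
Qed.

Lemma risk_le d (T : measurableType d) (R : realType)
    (Q : probability T R) (p K : nat) (S : 'M[R]_p) (X : T -> 'rV[R]_p)
    (w : 'I_K -> R) (bstar beta : 'rV[R]_p) (bs c : 'I_K -> R)
    (f : 'rV[R]_p -> 'I_K -> R) :
  (forall s, 0 <= w s) -> \sum_(s < K) w s = 1 ->
  (forall v : 'rV[R]_p, v != 0 -> 0 < qform S v) ->
  (forall j, measurable_fun setT (fun x => X x 0 j)) ->
  (forall (v : 'rV[R]_p) (A : set R), measurable A ->
     law Q (fun x => dotv v (X x)) A = gauss_law 0 (qform S v) A) ->
  (forall x s, f x s = dotv x beta + c s) ->
  (risk Q X w bstar bs f <=
   (qform S (beta - bstar) + \sum_(s < K) w s * (c s - bs s) ^+ 2)%:E)%E.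
Proof.
move=> w0 w1 S0 mX H fE.
have -> : qform S (beta - bstar) + \sum_(s < K) w s * (c s - bs s) ^+ 2 =
    \sum_(s < K) w s * (qform S (beta - bstar) + (c s - bs s) ^+ 2).
  under [RHS]eq_bigr do rewrite mulrDr.
  by rewrite big_split/= -mulr_suml w1 mul1r.
rewrite -sumEFin; apply: lee_sum => s _; rewrite EFinM lee_wpmul2l ?lee_fin//.
apply: le_trans (gaussian_vector_second_moment_le (beta - bstar) (c s - bs s) S0 mX H).
rewrite le_eqVlt; apply/orP; left; apply/eqP; apply: eq_integral => x _.
by rewrite fE dotvBr; congr _%:E; ring.
Qed.

(** * Weighted norms and the fair estimator *)

(** Lagrange's identity: the difference of the two sides is half a double sum of nonnegative
    terms. *)
Lemma weighted_cauchy_schwarz (R : realType) (I : finType) (w x y : I -> R) :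
  (forall i, 0 <= w i) ->
  (\sum_i w i * (x i * y i)) ^+ 2 <=
  (\sum_i w i * x i ^+ 2) * (\sum_i w i * y i ^+ 2).
Proof.
move=> w0.
have := @sumr_ge0 _ _ (index_enum I) xpredT
  (fun i => \sum_j w i * w j * (x i * y j - x j * y i) ^+ 2).
move=> /(_ (fun i _ => sumr_ge0 _ (fun j _ => mulr_ge0 (mulr_ge0 (w0 i) (w0 j)) (sqr_ge0 _)))).
have -> : \sum_i \sum_j w i * w j * (x i * y j - x j * y i) ^+ 2 =
   2 * ((\sum_i w i * x i ^+ 2) * (\sum_i w i * y i ^+ 2)
        - (\sum_i w i * (x i * y i)) ^+ 2).
  transitivity (\sum_i \sum_j ((w i * x i ^+ 2) * (w j * y j ^+ 2) +
    (w i * y i ^+ 2) * (w j * x j ^+ 2) +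
    (- 2 * (w i * (x i * y i))) * (w j * (x j * y j)))).
    by apply: eq_bigr => i _; apply: eq_bigr => j _; ring.
  under eq_bigr do rewrite !big_split/= -!mulr_sumr.
  by rewrite !big_split/= -!mulr_suml -mulr_sumr; ring.
lra.
Qed.

(** [q] is the squared norm of a further component, on which the second vector vanishes. In the risk
    bound it is the slope error, which shrinking the intercepts leaves unchanged. *)
Lemma weighted_minkowski (R : realType) (I : finType) (w x y : I -> R) (q A B : R) :
  (forall i, 0 <= w i) -> 0 <= q -> 0 <= A -> 0 <= B ->
  q + \sum_i w i * x i ^+ 2 <= A ^+ 2 -> \sum_i w i * y i ^+ 2 <= B ^+ 2 ->
  q + \sum_i w i * (x i + y i) ^+ 2 <= (A + B) ^+ 2.
Proof.
move=> w0 q0 A0 B0 hA hB.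
have X0 : 0 <= \sum_i w i * x i ^+ 2.
  by apply: sumr_ge0 => i _; rewrite mulr_ge0 ?sqr_ge0.
have Y0 : 0 <= \sum_i w i * y i ^+ 2.
  by apply: sumr_ge0 => i _; rewrite mulr_ge0 ?sqr_ge0.
have cs : \sum_i w i * (x i * y i) <= A * B.
  have AB0 : 0 <= A * B by exact: mulr_ge0.
  rewrite leNgt; apply/negP => h.
  have : (A * B) ^+ 2 < (\sum_i w i * (x i * y i)) ^+ 2.
    by rewrite ltr_pXn2r// ?nnegrE// (le_trans AB0)// ltW.
  apply/negP; rewrite -leNgt; apply: (le_trans (weighted_cauchy_schwarz x y w0)).
  by rewrite exprMn; apply: ler_pM => //; lra.
have -> : \sum_i w i * (x i + y i) ^+ 2 =
    \sum_i w i * x i ^+ 2 + 2 * (\sum_i w i * (x i * y i)) + \sum_i w i * y i ^+ 2.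
  rewrite mulr_sumr -!big_split/=; apply: eq_bigr => i _; ring.
nra.
Qed.

Lemma wvar_ge0 (R : realType) (K : nat) (w c : 'I_K -> R) :
  (forall s, 0 <= w s) -> 0 <= wvar w c.
Proof. by move=> w0; apply: sumr_ge0 => s _; rewrite mulr_ge0 ?sqr_ge0. Qed.

Lemma wvar_shrink (R : realType) (K : nat) (w b : 'I_K -> R) (r : R) :
  \sum_(s < K) w s = 1 ->
  wvar w (fun s => r * b s + (1 - r) * \sum_(s' < K) w s' * b s') = r ^+ 2 * wvar w b.
Proof.
move=> w1; rewrite /wvar; set cb := \sum_(s' < K) w s' * b s'.
have -> : \sum_(s' < K) w s' * (r * b s' + (1 - r) * cb) = cb.
  transitivity (\sum_(s < K) (r * (w s * b s) + w s * ((1 - r) * cb))).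
    by apply: eq_bigr => s _; ring.
  by rewrite big_split/= -mulr_sumr -mulr_suml w1 -/cb; ring.
by rewrite [RHS]mulr_sumr; apply: eq_bigr => s _; ring.
Qed.

(** The root of [wvar] is a seminorm, and the variance of b - c is at most its second moment. *)
Lemma sqrt_wvar_le (R : realType) (K : nat) (w b c : 'I_K -> R) (e : R) :
  (forall s, 0 <= w s) -> \sum_(s < K) w s = 1 -> 0 <= e ->
  \sum_(s < K) w s * (b s - c s) ^+ 2 <= e ^+ 2 ->
  Num.sqrt (wvar w b) <= Num.sqrt (wvar w c) + e.
Proof.
move=> w0 w1 e0 h.
have s0 := sqrtr_ge0 (wvar w c).
rewrite -(ler_pXn2r (ltn0Sn 1)) ?nnegrE ?addr_ge0 ?sqrtr_ge0//.
rewrite sqr_sqrtr; last exact: wvar_ge0.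
pose d s := b s - c s.
pose db := \sum_(s < K) w s * d s.
have -> : wvar w b = 0 + \sum_(s < K) w s *
    ((c s - \sum_(s' < K) w s' * c s') + (d s - db)) ^+ 2.
  rewrite add0r; apply: eq_bigr => s _; congr (_ * _ ^+ 2).
  have -> : db = \sum_(s < K) w s * b s - \sum_(s < K) w s * c s.
    by rewrite /db -sumrB; apply: eq_bigr => i _; rewrite mulrBr.
  by rewrite /d; ring.
apply: weighted_minkowski => //.
  by rewrite add0r sqr_sqrtr//; exact: wvar_ge0.
apply: le_trans h; apply: le_trans (wvar_le d 0 w1) _.
by under eq_bigr do rewrite subr0.
Qed.

(** If eps < u then sqrt tau * u = sqrt alpha (u - eps) <= sqrt alpha * us; otherwise u <= eps, and
    shrinking completely costs at most eps. *)
Lemma tau_hat_bounds (R : realType) (alpha eps u us : R) :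
  0 <= alpha <= 1 -> 0 <= eps -> 0 <= u -> 0 <= us -> u <= us + eps ->
  let tau := if eps < u then alpha * (1 + eps / (u - eps)) ^- 2 else 0 in
  tau * u ^+ 2 <= alpha * us ^+ 2 /\
  eps + (1 - Num.sqrt tau) * u <=
    2 * eps * (1 + Num.sqrt alpha) + (1 - Num.sqrt alpha) * us /\
  0 <= tau <= 1.
Proof.
move=> /andP[a0 a1] e0 u0 us0 uus.
set ra := Num.sqrt alpha.
have ra0 : 0 <= ra by exact: sqrtr_ge0.
have ra1 : ra <= 1 by rewrite -[leRHS]sqrtr1 ler_sqrt.
case: ifPn => [eu|] /=; last first.
  rewrite -leNgt => ue.
  by rewrite mul0r sqrtr0 subr0 mul1r lexx ler01 mulr_ge0 ?sqr_ge0//; split => //; split => //; nra.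
have u_gt0 : 0 < u by lra.
have ue : 0 < u - eps by lra.
pose r := (u - eps) / u.
have r0 : 0 <= r by rewrite divr_ge0// ltW.
have r1 : r <= 1 by rewrite ler_pdivrMr// mul1r; lra.
have ru : r * u = u - eps by rewrite /r divfK// gt_eqF.
have -> : alpha * (1 + eps / (u - eps)) ^- 2 = alpha * r ^+ 2.
  congr (_ * _); rewrite -exprVn; congr (_ ^+ 2); rewrite /r.
  by field; rewrite !gt_eqF.
have -> : Num.sqrt (alpha * r ^+ 2) = ra * r.
  by rewrite sqrtrM// sqrtr_sqr ger0_norm.
split; last split.
- rewrite -mulrA -exprMn ru ler_wpM2l// ler_pXn2r ?nnegrE//; lra.
- have -> : eps + (1 - ra * r) * u = eps + u - ra * (r * u) by ring.
  rewrite ru; nra.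
- apply/andP; split; first by rewrite mulr_ge0 ?sqr_ge0.
  by rewrite mulr_ile1 ?sqr_ge0// exprn_ile1.
Qed.

Lemma sqrte_le_EFin (R : realType) (x : \bar R) (m : R) : 0 <= m ->
  (x <= (m ^+ 2)%:E)%E -> (sqrte x <= m%:E)%E.
Proof.
move=> m0 xm; have -> : m%:E = sqrte (m ^+ 2)%:E by rewrite /= sqrtr_sqr ger0_norm.
by rewrite lee_sqrt// lee_fin sqr_ge0.
Qed.

(** The deterministic part. Both unfairnesses are weighted variances, with roots [u] and [us]; the
    error bound gives u <= us + eps, and [tau_hat_bounds] applies. *)
Lemma fair_estimator_bounds d (T : measurableType d) (R : realType)
    (Q : probability T R) (p K : nat) (S : 'M[R]_p) (X : T -> 'rV[R]_p)
    (w : 'I_K -> R) (bstar betahat : 'rV[R]_p) (bs bhat : 'I_K -> R)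
    (alpha sigma delta : R) :
  (forall s, 0 <= w s) -> \sum_(s < K) w s = 1 ->
  (forall v : 'rV[R]_p, v != 0 -> 0 < qform S v) ->
  (forall j, measurable_fun setT (fun x => X x 0 j)) ->
  (forall (v : 'rV[R]_p) (A : set R), measurable A ->
     law Q (fun x => dotv v (X x)) A = gauss_law 0 (qform S v) A) ->
  0 <= alpha <= 1 -> 0 < sigma -> 0 <= delta ->
  qform S (betahat - bstar) + \sum_(s < K) w s * (bhat s - bs s) ^+ 2
    <= sigma ^+ 2 * delta ->
  let U := unfairness Q X w in
  let tau := tau_hat alpha sigma delta (fine (sqrte (U (f_tau w 1 betahat bhat)))) in
  let fh := f_tau w tau betahat bhat in
  (U fh <= alpha%:E * U (fstar bstar bs))%E /\
  (sqrte (risk Q X w bstar bs fh) <=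
     (2 * sigma * (1 + Num.sqrt alpha) * Num.sqrt delta)%:E
     + (1 - Num.sqrt alpha)%:E * sqrte (U (fstar bstar bs)))%E.
Proof.
move=> w0 w1 S0 mX H a01 s0 d0 err U.
have UE beta f c : (forall x s, f x s = dotv x beta + c s) -> U f = (wvar w c)%:E.
  move=> fE; apply: (unfairness_translates w0 w1 (measurable_dotv beta mX)) => //.
  by move=> a; apply: le_lt_trans (gaussian_vector_second_moment_le beta a S0 mX H) _; exact: ltry.
pose cb := \sum_(s < K) w s * bhat s.
have UfE t : U (f_tau w t betahat bhat) = (Num.sqrt t ^+ 2 * wvar w bhat)%:E.
  by rewrite -(wvar_shrink bhat (Num.sqrt t) w1); apply: (UE betahat) => x s; rewrite /f_tau addrA.
rewrite UfE (UE bstar _ bs)// sqrtr1 expr1n mul1r /=.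
set u := Num.sqrt (wvar w bhat); set us := Num.sqrt (wvar w bs).
set eps := sigma * Num.sqrt delta.
have eps0 : 0 <= eps by rewrite mulr_ge0 ?sqrtr_ge0// ltW.
have eps2 : eps ^+ 2 = sigma ^+ 2 * delta by rewrite exprMn sqr_sqrtr.
have q0 : 0 <= qform S (betahat - bstar).
  have [->|/S0/ltW//] := eqVneq (betahat - bstar) 0.
  by rewrite /qform !mul0mx mxE.
have uus : u <= us + eps.
  apply: sqrt_wvar_le => //; rewrite eps2; apply: le_trans err.
  by rewrite lerDr.
have u2 : u ^+ 2 = wvar w bhat by rewrite sqr_sqrtr// wvar_ge0.
have us2 : us ^+ 2 = wvar w bs by rewrite sqr_sqrtr// wvar_ge0.
rewrite UfE /tau_hat -/eps.
have := tau_hat_bounds a01 eps0 (sqrtr_ge0 _ : 0 <= u) (sqrtr_ge0 _ : 0 <= us) uus.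
cbv zeta; set tau := (if _ then _ else _).
move=> [h1 [h2 /andP[t0 t1]]].
have rt0 := sqrtr_ge0 tau.
have rt1 : Num.sqrt tau <= 1 by rewrite -[leRHS]sqrtr1 ler_sqrt.
split; first by rewrite -EFinM lee_fin sqr_sqrtr// -u2 -us2.
rewrite -EFinM -EFinD (_ : 2 * sigma * (1 + Num.sqrt alpha) * Num.sqrt delta =
  2 * eps * (1 + Num.sqrt alpha)); last by rewrite /eps; ring.
apply: (@le_trans _ _ (eps + (1 - Num.sqrt tau) * u)%:E); last by rewrite lee_fin.
have m0 : 0 <= (1 - Num.sqrt tau) * u by rewrite mulr_ge0 ?sqrtr_ge0// subr_ge0.
apply: sqrte_le_EFin; first by rewrite addr_ge0.
apply: le_trans (risk_le bstar bs w0 w1 S0 mX H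
  (_ : forall x s, f_tau w tau betahat bhat x s = dotv x betahat +
     (Num.sqrt tau * bhat s + (1 - Num.sqrt tau) * cb))) _.
  by move=> x s; rewrite /f_tau addrA.
rewrite lee_fin.
(* The intercept error splits into the least-squares error and the displacement by shrinkage, of
   norm (1 - sqrt tau) u. *)
have -> : \sum_(s < K) w s * (Num.sqrt tau * bhat s + (1 - Num.sqrt tau) * cb - bs s) ^+ 2
    = \sum_(s < K) w s * ((bhat s - bs s) + (1 - Num.sqrt tau) * (cb - bhat s)) ^+ 2.
  by apply: eq_bigr => s _; congr (_ * _ ^+ 2); ring.
apply: weighted_minkowski => //; first by rewrite eps2.
rewrite exprMn u2 /wvar mulr_sumr le_eqVlt; apply/orP; left; apply/eqP.
by apply: eq_bigr => s _; rewrite -/cb; ring.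
Qed.

(** * Whitening of the sample *)

(** As k < p, some nonzero v satisfies v S B^T = 0; once normalized it is a new row orthonormal to
    the others for the form S. *)
Lemma orthonormal_family_extend (R : realType) (p k : nat) (S : 'M[R]_p) (B : 'M[R]_(k, p)) :
  S^T = S -> (forall u : 'rV[R]_p, u != 0 -> 0 < qform S u) -> (k < p)%N ->
  B *m S *m B^T = 1%:M ->
  exists B' : 'M[R]_(k + 1, p), B' *m S *m B'^T = 1%:M.
Proof.
move=> Ssym Spos kp BSB.
have /rowV0Pn [v vker vn0] : kermx (S *m B^T) != 0.
  rewrite -mxrank_eq0 mxrank_ker subn_eq0 -ltnNge.
  by apply: leq_ltn_trans kp; exact: rank_leq_col.
have vB : v *m S *m B^T = 0 by rewrite -mulmxA; apply/sub_kermxP.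
have q0 := Spos v vn0.
pose a := (Num.sqrt (qform S v))^-1.
have uB : (a *: v) *m S *m B^T = 0 by rewrite -!scalemxAl vB scaler0.
exists (col_mx B (a *: v)).
rewrite tr_col_mx mul_col_mx mul_col_mx !mul_mx_row uB BSB.
rewrite scalar_mx_block /block_mx; congr (col_mx (row_mx _ _) (row_mx _ _)).
- by apply: trmx_inj; rewrite trmx_mul trmxK trmx_mul Ssym mulmxA uB trmx0.
- apply/matrixP => i j; rewrite !ord1.
  have := qformZ S a v; rewrite /qform => ->.
  rewrite -/(qform S v) /a exprVn sqr_sqrtr ?(ltW q0)// mulVf ?gt_eqF//.
  by rewrite mxE.
Qed.

Lemma whitening (R : realType) (p : nat) (S : 'M[R]_p) :
  S^T = S -> (forall u : 'rV[R]_p, u != 0 -> 0 < qform S u) ->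
  exists B : 'M[R]_p, B *m S *m B^T = 1%:M.
Proof.
move=> Ssym Spos.
suff H k : (k <= p)%N -> exists B : 'M[R]_(k, p), B *m S *m B^T = 1%:M by exact: H.
elim: k => [_|k ih kp]; first by exists 0; apply/matrixP => -[].
have [B BSB] := ih (ltnW kp); rewrite -addn1.
exact: orthonormal_family_extend BSB.
Qed.

Lemma qform_whitened (R : realType) (p : nat) (S B : 'M[R]_p) (u : 'rV[R]_p) :
  B *m S *m B^T = 1%:M -> qform S (u *m B) = \sum_j u 0 j ^+ 2.
Proof.
move=> BSB; rewrite /qform trmx_mul.
have -> : u *m B *m S *m (B^T *m u^T) = u *m (B *m S *m B^T) *m u^T.
  by rewrite !mulmxA.
rewrite BSB mulmx1 mxE.
by apply: eq_bigr => j _; rewrite mxE expr2.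
Qed.

Lemma dotv_mulmx (R : realType) (p : nat) (x u : 'rV[R]_p) (B : 'M[R]_p) :
  dotv x (u *m B) = \sum_j u 0 j * dotv x (row j B).
Proof.
rewrite /dotv; under eq_bigr do rewrite mxE mulr_sumr.
rewrite exchange_big/=; apply: eq_bigr => j _; rewrite mulr_sumr.
by apply: eq_bigr => i _; rewrite mxE; ring.
Qed.

Lemma sum_samples (R : realType) (K : nat) (ns : 'I_K -> nat)
    (F : {s : 'I_K & 'I_(ns s)} -> R) :
  \sum_i F i = \sum_(s < K) \sum_(i < ns s) F (Tagged (fun s => 'I_(ns s)) i).
Proof.
rewrite (sig_big_dep (fun=> true) (fun _ => xpredT)
  (fun s i => F (Tagged (fun s => 'I_(ns s)) i)))/=.
by apply: eq_bigr => -[].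
Qed.

(** Coordinates of the design rows along the rows of [B]: independent standard normals when B S B^T
    = 1. All observations are indexed jointly by pairs (group, position). *)
Definition whitened {R : realType} (p K : nat) (ns : 'I_K -> nat) (B : 'M[R]_p)
    (X : forall s : 'I_K, 'M[R]_(ns s, p)) (i : {s : 'I_K & 'I_(ns s)}) (j : 'I_p) : R :=
  dotv (row (tagged i) (X (tag i))) (row j B).

(** The whitened design and the rescaled noise have the exponential moments of independent standard
    normals: [A] and [C] pull a linear form in them back to one in [X] and [xi]. *)
Lemma sample_mgf d (T : measurableType d) (R : realType) (P : probability T R)
    (p K : nat) (ns : 'I_K -> nat) (S B : 'M[R]_p) (sigma : R)
    (X : forall s : 'I_K, T -> 'M[R]_(ns s, p)) (xi : forall s : 'I_K, T -> 'cV[R]_(ns s)) :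
  B *m S *m B^T = 1%:M -> 0 < sigma ->
  (forall s i j, measurable_fun setT (fun w => X s w i j)) ->
  (forall s i, measurable_fun setT (fun w => xi s w i 0)) ->
  (forall (A : forall s : 'I_K, 'M[R]_(ns s, p))
          (c : forall s : 'I_K, 'cV[R]_(ns s)) (E : set R), measurable E ->
     law P (fun w => \sum_(s < K) (\sum_(i < ns s) \sum_(j < p) A s i j * X s w i j
                                  + \sum_(i < ns s) c s i 0 * xi s w i 0)) E
     = gauss_law 0 (\sum_(s < K) (\sum_(i < ns s) qform S (row i (A s))
                                  + sigma ^+ 2 * \sum_(i < ns s) c s i 0 ^+ 2)) E) ->
  forall (a : {s : 'I_K & 'I_(ns s)} -> 'I_p -> R) (c : {s : 'I_K & 'I_(ns s)} -> R),
  (\int[P]_w (expR (\sum_i (\sum_j a i j * whitened B (X^~ w) i j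
                  + c i * (xi (tag i) w (tagged i) 0 / sigma))))%:E
   = (expR (\sum_i (\sum_j a i j ^+ 2 + c i ^+ 2) / 2))%:E)%E.
Proof.
move=> BSB s0 mX mxi H a c.
pose A (s : 'I_K) : 'M[R]_(ns s, p) :=
  \matrix_(i < ns s) ((\row_j a (Tagged (fun s => 'I_(ns s)) i) j) *m B).
pose C (s : 'I_K) : 'cV[R]_(ns s) :=
  \col_(i < ns s) (c (Tagged (fun s => 'I_(ns s)) i) / sigma).
have mY : measurable_fun setT (fun w =>
    \sum_(s < K) (\sum_(i < ns s) \sum_(j < p) A s i j * X s w i j
                  + \sum_(i < ns s) C s i 0 * xi s w i 0)).
  apply: measurable_sum => s; apply: measurable_funD; apply: measurable_sum => i.
    by apply: measurable_sum => j; exact: measurable_funM.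
  exact: measurable_funM.
have vE : \sum_(s < K) (\sum_(i < ns s) qform S (row i (A s))
      + sigma ^+ 2 * \sum_(i < ns s) C s i 0 ^+ 2)
    = \sum_(i : {s : 'I_K & 'I_(ns s)}) (\sum_j a i j ^+ 2 + c i ^+ 2).
  rewrite sum_samples; apply: eq_bigr => s _; rewrite mulr_sumr -big_split/=.
  apply: eq_bigr => i _; rewrite rowK (qform_whitened _ BSB) mxE; congr (_ + _).
    by apply: eq_bigr => j _; rewrite mxE.
  by field; rewrite gt_eqF.
rewrite -mulr_suml -vE -(integral_exp_gauss_law mY _ (H A C)).
  apply: eq_integral => w _; congr (expR _)%:E; rewrite sum_samples.
  apply: eq_bigr => s _; rewrite -big_split/=; apply: eq_bigr => i _.
  rewrite mxE mulrAC mulrA; congr (_ + _).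
  transitivity (dotv (row i (X s w)) (\row_j a (Tagged (fun s => 'I_(ns s)) i) j *m B)).
    by rewrite dotv_mulmx; apply: eq_bigr => j _; rewrite mxE.
  by apply: eq_bigr => j _; rewrite !mxE mulrC; congr (_ * _); apply: eq_bigr => k _; rewrite !mxE.
rewrite vE; apply: sumr_ge0 => i _; rewrite addr_ge0 ?sqr_ge0//.
by apply: sumr_ge0 => j _; rewrite sqr_ge0.
Qed.

(** * Rounding to the lattice *)

(** For y = u + f between the integers u and u + 1, (1 - f) phi(u) + f phi(u + 1) = phi(y) + ga f (1
    - f) >= phi(y) - a/4, so one of the two neighbors loses at most a/4. Integers are encoded as k -
    N, and the margin 1 in the bound on |y| keeps both neighbors in range. *)
Lemma round_quadratic (R : realType) (al be ga a y : R) (N : nat) :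
  0 <= a -> - a <= ga -> `|y| + 1 <= N%:R ->
  exists k : 'I_(N.*2.+1), `|k%:R - N%:R - y| <= 1 /\
    al + be * y + ga * y ^+ 2 - a / 4 <=
    al + be * (k%:R - N%:R) + ga * (k%:R - N%:R) ^+ 2.
Proof.
move=> a0 ga_a yN.
have [y1 y2] : - N%:R + 1 <= y /\ y <= N%:R - 1.
  have : `|y| <= N%:R - 1 by lra.
  by rewrite ler_norml => /andP[]; split; lra.
have z0 : 0 <= y + N%:R by lra.
have := truncn_itv z0; set m := Num.truncn _ => /andP[mz zm].
have mN : (m.+1 <= N.*2)%N.
  rewrite -(ler_nat R) -(natr1 m) -muln2 natrM. lra.
pose f := y + N%:R - m%:R.
have f0 : 0 <= f by rewrite /f; lra.
have f1 : f <= 1 by move: zm; rewrite /f -(natr1 m); lra.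
pose phi t := al + be * t + ga * t ^+ 2.
pose u : R := m%:R - N%:R.
have yu : y = u + f by rewrite /u /f; ring.
have cvx : (1 - f) * phi u + f * phi (u + 1) = phi y + ga * (f * (1 - f)).
  by rewrite /phi yu; ring.
have ff : f * (1 - f) <= 4^-1 by have := sqr_ge0 (f - 2^-1); lra.
have ff0 : 0 <= f * (1 - f) by rewrite mulr_ge0// subr_ge0.
have gf : - (a / 4) <= ga * (f * (1 - f)) by nra.
have [h|h] := lerP (phi y - a / 4) (phi u).
  have mlt : (m < N.*2.+1)%N by rewrite ltnS ltnW.
  exists (Ordinal mlt) => /=; split => //.
  by rewrite -/u yu ler_norml; apply/andP; split; lra.
exists (Ordinal (mN : (m.+1 < N.*2.+1)%N)) => /=.
have -> : m.+1%:R - N%:R = u + 1 by rewrite /u -(natr1 m); ring.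
split; first by rewrite yu ler_norml; apply/andP; split; lra.
rewrite -/(phi y) -/(phi (u + 1)) leNgt; apply/negP => h'.
have [f_eq0|fn0] := eqVneq f 0; first by move: cvx; rewrite f_eq0; lra.
have f_gt0 : 0 < f by rewrite lt_neqAle eq_sym fn0.
by nra.
Qed.

(** Coordinates are rounded one after another; the curvature [ga j] does not depend on the other
    coordinates, so the losses a_j/4 add up. *)
Lemma round_coordinates (R : realType) (J : finType) (F : (J -> R) -> R)
    (ga a : J -> R) (y : J -> R) (N : nat) :
  (forall j, 0 <= a j) -> (forall j, - a j <= ga j) ->
  (forall j, `|y j| + 1 <= N%:R) ->
  (forall (z : J -> R) j, exists al be, forall t,
     F (fun i => if i == j then t else z i) = al + be * t + ga j * t ^+ 2) ->
  exists k : {ffun J -> 'I_(N.*2.+1)},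
    (forall j, `|(k j)%:R - N%:R - y j| <= 1) /\
    F y - (\sum_j a j) / 4 <= F (fun j => (k j)%:R - N%:R).
Proof.
move=> a0 ga_a yN quad.
suff H (r : seq J) : uniq r -> exists k : {ffun J -> 'I_(N.*2.+1)},
    (forall j, j \in r -> `|(k j)%:R - N%:R - y j| <= 1) /\
    F y - (\sum_(j <- r) a j) / 4 <=
    F (fun j => if j \in r then (k j)%:R - N%:R else y j).
  have [k [k1 k2]] := H (enum J) (enum_uniq J); exists k; split.
    by move=> j; apply: k1; rewrite mem_enum.
  move: k2; rewrite big_enum/=.
  congr (is_true (_ <= F _)); apply/funext => j.
  by rewrite mem_enum.
elim: r => [_|j r ih /= /andP[jr ur]].
  exists [ffun=> ord0]; split => //; by rewrite big_nil mul0r subr0.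
have [k [k1 k2]] := ih ur.
pose z i := if i \in r then (k i)%:R - N%:R else y i.
have [al [be Fq]] := quad z j.
have [kj [kj1 kj2]] := @round_quadratic R al be (ga j) (a j) (y j) N (a0 j) (ga_a j) (yN j).
exists [ffun i => if i == j then kj else k i]; split.
  move=> i; rewrite inE ffunE; case: eqVneq => [->//|_ /= ir]; exact: k1.
rewrite big_cons mulrDl opprD [- _ - _]addrC addrA.
have zE : F z = al + be * y j + ga j * y j ^+ 2.
  rewrite -Fq; congr F; apply/funext => i; case: eqVneq => [->|//].
  by rewrite /z (negbTE jr).
rewrite -/z zE in k2.
apply: (le_trans (lerB k2 (lexx _))); apply: (le_trans kj2).
rewrite -Fq le_eqVlt; apply/orP; left; apply/eqP; congr F; apply/funext => i.
by rewrite inE ffunE /z; case: eqVneq.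
Qed.

(** * The lattice functional and Gaussian weights on the lattice *)

(** The exponent <M y, xi> - |M y|^2, plus a diagonal form meant to offset the decay of its
    exponential moment. *)
Definition lattice_functional {R : realType} (I J : finType) (M : I -> J -> R)
    (xi : I -> R) (c : J -> R) (y : J -> R) : R :=
  \sum_i ((\sum_j M i j * y j) * xi i - (\sum_j M i j * y j) ^+ 2)
  + \sum_j c j * y j ^+ 2.

Lemma lattice_functional_quadratic (R : realType) (I J : finType) (M : I -> J -> R)
    (xi : I -> R) (c : J -> R) (z : J -> R) (j : J) :
  exists al be, forall t,
    lattice_functional M xi c (fun i => if i == j then t else z i) =
    al + be * t + (c j - \sum_i M i j ^+ 2) * t ^+ 2.
Proof.
pose u i := \sum_(k | k != j) M i k * z k.
have uE t i : \sum_k M i k * (if k == j then t else z k) = u i + M i j * t.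
  rewrite (bigD1 j)//= eqxx addrC; congr (_ + _).
  by apply: eq_bigr => k /negbTE ->.
exists (\sum_i (u i * xi i - u i ^+ 2) + \sum_(k | k != j) c k * z k ^+ 2).
exists (\sum_i (M i j * xi i - 2 * u i * M i j)) => t.
rewrite /lattice_functional; under eq_bigr do rewrite uE.
rewrite (bigD1 j (F := fun k => c k * _))//= eqxx.
rewrite (eq_bigr (fun k => c k * z k ^+ 2)); last by move=> k /negbTE ->.
have -> : \sum_i ((u i + M i j * t) * xi i - (u i + M i j * t) ^+ 2) =
  \sum_i (u i * xi i - u i ^+ 2) + (\sum_i (M i j * xi i - 2 * u i * M i j)) * t
  - (\sum_i M i j ^+ 2) * t ^+ 2.
  rewrite !mulr_suml -big_split -sumrB/=; apply: eq_bigr => i _; ring.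
ring.
Qed.

Lemma expR_lower_bound (R : realType) (x : R) (m : nat) : 0 <= x ->
  (1 + x / m.+1%:R) ^+ m.+1 <= expR x.
Proof.
move=> x0; have -> : expR x = expR (x / m.+1%:R) ^+ m.+1.
  by rewrite -expRM_natl mulrC divfK// pnatr_eq0.
rewrite lerXn2r ?nnegrE ?expR_ge0 ?expR_ge1Dx//.
by rewrite addr_ge0// divr_ge0.
Qed.

(** A truncated theta series. The full sum of e^(-k^2/5) is about sqrt (5 pi) = 3.96, slightly below
    the bound 4.04 proved here. *)
Definition discrete_gaussian_mass {R : realType} (N : nat) : R :=
  \sum_(i < N.*2.+1) expR (- ((i%:R - N%:R) ^+ 2 / 5)).

Lemma discrete_gaussian_massS (R : realType) (N : nat) :
  discrete_gaussian_mass N.+1 =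
  discrete_gaussian_mass N + 2 * expR (- 5^-1) ^+ (N.+1 ^ 2) :> R.
Proof.
have qE (t : R) : t ^+ 2 = N.+1%:R ^+ 2 -> expR (- (t ^+ 2 / 5)) = expR (- 5^-1) ^+ (N.+1 ^ 2).
  by move=> ->; rewrite -expRM_natl -natrX; congr expR; rewrite mulrN.
rewrite /discrete_gaussian_mass doubleS big_ord_recl big_ord_recr/=.
rewrite (qE (0%:R - _)); last by rewrite sub0r sqrrN.
rewrite (qE (_ - _)); last first.
  congr (_ ^+ 2); rewrite /bump/= add1n -addnn -addSn -addnS natrD; ring.
rewrite [RHS]addrC mulrDl mul1r -addrA; congr (_ + _); rewrite addrC; congr (_ + _).
apply: eq_bigr => i _; congr (expR (- (_ ^+ 2 / 5))).
by rewrite /bump/= add1n -(natr1 i) -(natr1 N); ring.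
Qed.

(** e^x >= (1 + x/32)^32, evaluated by five squarings, each rounded down. *)
Lemma expR_36_25_ge (R : realType) : 404 / 100 <= expR (36 / 25) :> R.
Proof.
apply: le_trans (expR_lower_bound 31 _); last by lra.
have -> : 1 + 36 / 25 / 32%:R = 209 / 200 :> R by field.
have sq (x c e : R) : 0 <= c -> c <= x -> e <= c ^+ 2 -> e <= x ^+ 2.
  move=> c0 cx ec; apply: (le_trans ec).
  by rewrite ler_pXn2r// ?nnegrE// (le_trans c0).
have e2 : 1092 / 1000 <= (209 / 200 : R) ^+ 2.
  by rewrite expr2; lra.
have e4 : 1192 / 1000 <= (209 / 200 : R) ^+ 4.
  by rewrite (exprM _ 2 2); apply: (sq _ _ _ _ e2); clear; rewrite ?expr2; lra.
have e8 : 1420 / 1000 <= (209 / 200 : R) ^+ 8.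
  by rewrite (exprM _ 4 2); apply: (sq _ _ _ _ e4); clear; rewrite ?expr2; lra.
have e16 : 2016 / 1000 <= (209 / 200 : R) ^+ 16.
  by rewrite (exprM _ 8 2); apply: (sq _ _ _ _ e8); clear; rewrite ?expr2; lra.
by rewrite (exprM _ 16 2); apply: (sq _ _ _ _ e16); clear; rewrite ?expr2; lra.
Qed.

Lemma discrete_gaussian_mass_le (R : realType) (N : nat) :
  discrete_gaussian_mass N <= expR (36 / 25) :> R.
Proof.
pose q : R := expR (- 5^-1).
have q0 : 0 <= q := expR_ge0 _.
have q1 : q <= 14 / 17.
  have qe : q * expR 5^-1 = 1 by rewrite /q -expRD addNr expR0.
  have : 243 / 200 <= expR (5^-1) :> R.
    apply: le_trans (expR_lower_bound 3 _); last by rewrite invr_ge0.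
    have -> : 1 + 5^-1 / 4%:R = 21 / 20 :> R by field.
    have h2 : (21 / 20 : R) ^+ 2 = 441 / 400 by field.
    by rewrite (exprM _ 2 2) h2 expr2; lra.
  by nra.
have mono n m : (n <= m)%N -> discrete_gaussian_mass n <= discrete_gaussian_mass m :> R.
  move=> /subnKC <-; elim: (m - n)%N => [|k ih]; first by rewrite addn0.
  rewrite addnS; apply: (le_trans ih); rewrite discrete_gaussian_massS lerDl.
  by rewrite mulr_ge0// exprn_ge0.
have mul_le (x y c e f : R) : 0 <= x <= c -> 0 <= y <= e -> c * e <= f ->
    0 <= x * y <= f.
  move=> /andP[x0 xc] /andP[y0 ye] cef; rewrite mulr_ge0//=.
  by apply: le_trans cef; exact: ler_pM.
have q01 : 0 <= q <= 14 / 17 by rewrite q0.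
have q2 : 0 <= q ^+ 2 <= 19 / 28.
  by rewrite expr2; apply: (mul_le _ _ _ _ _ q01 q01); clear; lra.
have q4 : 0 <= q ^+ 4 <= 6 / 13.
  by rewrite (exprD q 2 2); apply: (mul_le _ _ _ _ _ q2 q2); clear; lra.
have q8 : 0 <= q ^+ 8 <= 3 / 14.
  by rewrite (exprD q 4 4); apply: (mul_le _ _ _ _ _ q4 q4); clear; lra.
have q16 : 0 <= q ^+ 16 <= 9 / 196.
  by rewrite (exprD q 8 8); apply: (mul_le _ _ _ _ _ q8 q8); clear; lra.
have q9 : 0 <= q ^+ 9 <= 3 / 17.
  by rewrite (exprD q 8 1); apply: (mul_le _ _ _ _ _ q8 q01); clear; lra.
have q25 : 0 <= q ^+ 25 <= 9 / 196 * (3 / 17).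
  by rewrite (exprD q 16 9); apply: (mul_le _ _ _ _ _ q16 q9); clear; lra.
have q1' : q <= 1 by apply: (le_trans q1); clear; lra.
(* With the correction 3 q^((k+5)^2) the mass is nonincreasing in k: the two new terms and the next
   correction fit because 2 + 3 q^9 <= 3. Everything reduces to the value at 4. *)
have tail k : discrete_gaussian_mass (k + 4) + 3 * q ^+ ((k + 5) ^ 2) <=
     discrete_gaussian_mass 4 + 3 * q ^+ 25 :> R.
  elim: k => [|k ih]; first by rewrite !add0n.
  apply: le_trans ih; rewrite addSn discrete_gaussian_massS -/q -addrA lerD2l.
  have -> : (k + 4).+1 = (k + 5)%N by rewrite -addnS.
  have -> : ((k.+1 + 5) ^ 2 = (k + 5) ^ 2 + (9 + (2 * k + 2)))%N.
    rewrite addSn -addn1 sqrnD exp1n muln1 mulnDr -addnA; congr (_ + _)%N.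
    by rewrite addnCA [RHS]addnCA.
  set s := ((k + 5) ^ 2)%N; rewrite exprD [q ^+ (9 + _)]exprD.
  have qs : 0 <= q ^+ s by rewrite exprn_ge0.
  have qk : 0 <= q ^+ (2 * k + 2) <= 1 by rewrite exprn_ge0//= exprn_ile1.
  have /andP[_ r1] : 0 <= q ^+ 9 * q ^+ (2 * k + 2) <= 3 / 17.
    by apply: (mul_le _ _ _ _ _ q9 qk); clear; lra.
  move: (q ^+ 9 * _) (q ^+ s) r1 qs; clear; move=> r z r1 qs; nra.
have m4 : discrete_gaussian_mass 4 = 1 + 2 * (q + q ^+ 4 + q ^+ 9 + q ^+ 16) :> R.
  rewrite !discrete_gaussian_massS /discrete_gaussian_mass big_ord1/=.
  by rewrite subr0 expr0n/= mul0r oppr0 expR0 -/q; ring.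
have : discrete_gaussian_mass N <= 404 / 100 :> R.
  apply: (le_trans (mono N (N + 4)%N (leq_addr _ _))).
  have : 0 <= q ^+ ((N + 5) ^ 2) by rewrite exprn_ge0.
  have := tail N; rewrite m4.
  move: q1 q4 q9 q16 q25 => + /andP[_ +] /andP[_ +] /andP[_ +] /andP[_ +].
  clear; lra.
by move=> /le_trans; apply; exact: expR_36_25_ge.
Qed.

(** The sum factors over the coordinates. These are the subprobability weights for the sum over the
    lattice. *)
Lemma lattice_prior_le1 (R : realType) (J : finType) (N : nat) :
  \sum_(k : {ffun J -> 'I_(N.*2.+1)})
    expR (- (\sum_j ((k j)%:R - N%:R) ^+ 2 / 5) - 36 / 25 * #|J|%:R) <= 1 :> R.
Proof.
have -> : \sum_(k : {ffun J -> 'I_(N.*2.+1)})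
    expR (- (\sum_j ((k j)%:R - N%:R) ^+ 2 / 5) - 36 / 25 * #|J|%:R)
  = \sum_(k : {ffun J -> 'I_(N.*2.+1)}) \prod_j
     expR (- (((k j)%:R - N%:R) ^+ 2 / 5) - 36 / 25) :> R.
  apply: eq_bigr => k _; rewrite -expR_sum; congr expR.
  by rewrite big_split/= !sumrN sumr_const mulr_natr.
rewrite -(bigA_distr_bigA (fun _ (i : 'I_(N.*2.+1)) =>
   expR (- ((i%:R - N%:R) ^+ 2 / 5) - 36 / 25)))/=.
apply: prodr_ile1 => j _; rewrite sumr_ge0 => [/=|i _]; last exact: expR_ge0.
under eq_bigr do rewrite expRD.
rewrite -mulr_suml expRN ler_pdivrMr ?expR_gt0// mul1r.
exact: discrete_gaussian_mass_le.
Qed.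

(** * Consequences of the sample-size condition *)

(** With x = (sqrt p + sqrt t)/sqrt n, the hypothesis puts x below the smaller root of x^2 - th x +
    3/4, so th x <= 3/4 + x^2. As th >= 5, that root is at most 1/6, and 3/4 + 1/36 = 7/9. *)
Lemma sample_size_condition (R : realType) (p K n t : R) :
  0 <= p -> 0 <= K -> 0 < t -> 0 <= n ->
  let th := theta p K t in
  2 * (Num.sqrt p + Num.sqrt t) / (th - Num.sqrt (th ^+ 2 - 3)) <= Num.sqrt n ->
  0 < n /\
  6 * Num.sqrt (p / n) + 4 * Num.sqrt (K / n) + 5 * Num.sqrt (t / n) <= 7 / 9 /\
  t / n <= 36^-1.
Proof.
move=> p0 K0 t0 n0 th hyp.
have sp0 := sqrtr_ge0 p; have sK0 := sqrtr_ge0 K.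
have st0 : 0 < Num.sqrt t by rewrite sqrtr_gt0.
set z := Num.sqrt p + Num.sqrt t in hyp.
have z0 : 0 < z by rewrite /z; lra.
have thz : th * z = 4 * Num.sqrt K + 5 * Num.sqrt t + 6 * Num.sqrt p.
  by rewrite /th /theta -/z divfK// gt_eqF.
have th5 : 5 <= th.
  by rewrite -(ler_pM2r z0) thz /z; lra.
set s := Num.sqrt (th ^+ 2 - 3) in hyp.
have s2 : s ^+ 2 = th ^+ 2 - 3 by rewrite sqr_sqrtr//; nra.
have s0 : 0 <= s := sqrtr_ge0 _.
have sth : s < th.
  by rewrite -(ltr_pXn2r (ltn0Sn 1)) ?nnegrE//; lra.
have s4 : 4 <= s.
  by rewrite -(ler_pXn2r (ltn0Sn 1)) ?nnegrE// s2; nra.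
have y0 : 0 < th - s by lra.
move: hyp; rewrite ler_pdivrMr// => hyp.
have n_gt0 : 0 < n.
  rewrite lt_neqAle n0 andbT; apply/eqP => n_eq0.
  by move: hyp; rewrite -n_eq0 sqrtr0 mul0r; lra.
split => //.
have sn0 : 0 < Num.sqrt n by rewrite sqrtr_gt0.
have sdiv a : 0 <= a -> Num.sqrt (a / n) = Num.sqrt a / Num.sqrt n.
  by move=> a0; rewrite sqrtrM// sqrtrV// ltW.
pose x := z / Num.sqrt n.
have x0 : 0 < x by rewrite divr_gt0.
have xy : x <= (th - s) / 2.
  by rewrite /x ler_pdivrMr//; lra.
have thx : th * x <= 3 / 4 + x ^+ 2 by nra.
have x6 : x <= 6^-1 by nra.
split.
  rewrite !sdiv// ?(ltW t0)//.
  have : th * x = (4 * Num.sqrt K + 5 * Num.sqrt t + 6 * Num.sqrt p) / Num.sqrt n.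
    by rewrite /x mulrA thz.
  have -> : 6 * (Num.sqrt p / Num.sqrt n) + 4 * (Num.sqrt K / Num.sqrt n)
      + 5 * (Num.sqrt t / Num.sqrt n) =
    (4 * Num.sqrt K + 5 * Num.sqrt t + 6 * Num.sqrt p) / Num.sqrt n by ring.
  by move=> <-; nra.
have tx : Num.sqrt (t / n) <= x.
  by rewrite sdiv ?(ltW t0)// /x ler_pM2r ?invr_gt0// /z; lra.
have T0 := sqrtr_ge0 (t / n).
have -> : t / n = Num.sqrt (t / n) ^+ 2 by rewrite sqr_sqrtr// divr_ge0// ltW.
by nra.
Qed.

(** Keeps the rounded slope part within the range 1/3 of the exponential bound. 20/7 and 10/7 are
    rational upper bounds for sqrt 8 and sqrt 2; the last sum is at most 5/7 * 7/9 = 5/9, and 25/81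
    < 1/3. *)
Lemma rounding_radius (R : realType) (P Q T r2 : R) :
  0 <= P -> 0 <= Q -> 0 <= T ->
  6 * P + 4 * Q + 5 * T <= 7 / 9 ->
  r2 <= 8 * P ^+ 2 + 8 * Q ^+ 2 + 4 * T ^+ 2 ->
  r2 <= (20 / 7 * (P + Q) + 2 * T) ^+ 2 /\
  2 * P ^+ 2 <= (10 / 7 * P) ^+ 2 /\
  (20 / 7 * (P + Q) + 2 * T + 10 / 7 * P) ^+ 2 <= 3^-1.
Proof.
move=> P0 Q0 T0 h hr; split; last split.
- apply: (le_trans hr).
  have := mulr_ge0 P0 Q0; have := mulr_ge0 P0 T0; have := mulr_ge0 Q0 T0.
  have := sqr_ge0 P; have := sqr_ge0 Q.
  rewrite !expr2; lra.
- have := sqr_ge0 P; rewrite !expr2; lra.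
- set g := (X in X ^+ 2).
  have g0 : 0 <= g by rewrite /g; lra.
  have g1 : g <= 5 / 9 by rewrite /g; lra.
  clear -g0 g1; nra.
Qed.

(** * The least-squares error *)

(* In the coordinates [y = (u, sqrt w * b) / h] with [h^2 = 2/n], the lattice is
   the integer lattice and the columns indexed by nonempty groups have squared
   norm 2; the columns of empty groups vanish because of [0^-1 = 0]. *)
Definition design {R : realType} (p K : nat) (ns : 'I_K -> nat) (h : R)
    (Z : {s : 'I_K & 'I_(ns s)} -> 'I_p -> R)
    (i : {s : 'I_K & 'I_(ns s)}) (j : 'I_p + 'I_K) : R :=
  match j with
  | inl j => h * Z i j
  | inr s => h * ((tag i == s)%:R / Num.sqrt (weight ns s))
  end.

(** The decay 3/8 times n h^2 = 2 gives 3/4 per coordinate, of which 1/5 is kept for summing over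
    the lattice. Columns of empty groups vanish and bring no decay. *)
Definition curvature {R : realType} (p K : nat) (ns : 'I_K -> nat)
    (j : 'I_p + 'I_K) : R :=
  match j with
  | inl _ => 11 / 20
  | inr s => 3 / 4 * (ns s != 0)%:R - 5^-1
  end.

Lemma sumr_sumType (R : realType) (A B : finType) (F : A + B -> R) :
  \sum_j F j = \sum_a F (inl a) + \sum_b F (inr b).
Proof. exact: big_sumType. Qed.

Lemma weight_ge0 (R : realType) (K : nat) (ns : 'I_K -> nat) (s : 'I_K) :
  0 <= weight ns s :> R.
Proof. by rewrite /weight divr_ge0. Qed.

Lemma weight_gt0 (R : realType) (K : nat) (ns : 'I_K -> nat) (s : 'I_K) :
  ns s != 0%N -> 0 < weight ns s :> R.
Proof.
move=> ns0; have n0 : (0 : R) < (ns s)%:R by rewrite ltr0n lt0n.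
by rewrite /weight divr_gt0// (bigD1 s)//= natrD ltr_wpDr.
Qed.

Lemma sum_weight (R : realType) (K : nat) (ns : 'I_K -> nat) :
  (0 : R) < (\sum_(s < K) ns s)%:R -> \sum_(s < K) weight ns s = 1 :> R.
Proof. by move=> n0; rewrite /weight -mulr_suml -natr_sum divff// gt_eqF. Qed.

Lemma sum_design_group_sqr (R : realType) (p K : nat) (ns : 'I_K -> nat) (h : R)
    (Z : {s : 'I_K & 'I_(ns s)} -> 'I_p -> R) (s : 'I_K) :
  (0 : R) < (\sum_(s < K) ns s)%:R -> h ^+ 2 = 2 / (\sum_(s < K) ns s)%:R ->
  \sum_i design h Z i (inr s) ^+ 2 = 2 * (ns s != 0%N)%:R.
Proof.
move=> n0 h2; rewrite sum_samples (bigD1 s)//= eqxx.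
rewrite [X in _ + X]big1 ?addr0; last first.
  by move=> s' /negbTE ne; rewrite big1// => i _; rewrite ne mul0r mulr0 expr0n.
rewrite sumr_const card_ord mul1r exprMn exprVn sqr_sqrtr ?weight_ge0// h2.
have [ns0|ns0] := eqVneq (ns s) 0%N; first by rewrite ns0 mulr0n mulr0.
have m0 : (ns s)%:R != 0 :> R by rewrite pnatr_eq0.
rewrite mulr1 -mulr_natr /weight natr_sum.
by move: n0; rewrite natr_sum => n0; field; rewrite m0 gt_eqF.
Qed.

Lemma design_mul (R : realType) (p K : nat) (ns : 'I_K -> nat) (h : R)
    (Z : {s : 'I_K & 'I_(ns s)} -> 'I_p -> R) i (y : 'I_p + 'I_K -> R) :
  \sum_j design h Z i j * y j =
  \sum_j h * y (inl j) * Z i j + design h Z i (inr (tag i)) * y (inr (tag i)).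
Proof.
rewrite sumr_sumType; congr (_ + _); first by apply: eq_bigr => j _ /=; ring.
rewrite (bigD1 (tag i))//= big1 ?addr0// => s.
by rewrite eq_sym => /negbTE ->; rewrite mul0r mulr0 mul0r.
Qed.

Lemma sum_design_group_mul_sqr (R : realType) (p K : nat) (ns : 'I_K -> nat) (h : R)
    (Z : {s : 'I_K & 'I_(ns s)} -> 'I_p -> R) (y : 'I_K -> R) :
  (0 : R) < (\sum_(s < K) ns s)%:R -> h ^+ 2 = 2 / (\sum_(s < K) ns s)%:R ->
  \sum_i (design h Z i (inr (tag i)) * y (tag i)) ^+ 2 =
  \sum_(s < K) 2 * (ns s != 0%N)%:R * y s ^+ 2.
Proof.
move=> n0 h2.
rewrite sum_samples; apply: eq_bigr => s _.
rewrite -(sum_design_group_sqr Z s n0 h2) sum_samples mulr_suml (bigD1 s)//=.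
rewrite [X in _ + X]big1 ?addr0; last first.
  move=> s' /negbTE ne; rewrite big1 ?mul0r// => i _.
  by rewrite ne mul0r mulr0 expr0n.
by rewrite mulr_suml; apply: eq_bigr => i _; rewrite eqxx exprMn.
Qed.

(** [r] is the variance of the Gaussian part of each entry of the design times y, and [b i] its
    deterministic group part; [curvature] turns - 3/8 sum (r + b_i^2) into - sum y_j^2/5. *)
Lemma integral_lattice_functional_le d (T : measurableType d) (R : realType)
    (P : probability T R) (p K : nat) (ns : 'I_K -> nat) (h : R)
    (Z : T -> {s : 'I_K & 'I_(ns s)} -> 'I_p -> R)
    (xi : T -> {s : 'I_K & 'I_(ns s)} -> R) (y : 'I_p + 'I_K -> R) :
  (0 : R) < (\sum_(s < K) ns s)%:R -> h ^+ 2 = 2 / (\sum_(s < K) ns s)%:R ->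
  (forall i j, measurable_fun setT (fun w => Z w i j)) ->
  (forall i, measurable_fun setT (fun w => xi w i)) ->
  (forall (a : {s : 'I_K & 'I_(ns s)} -> 'I_p -> R) c,
    \int[P]_w (expR (\sum_i (\sum_j a i j * Z w i j + c i * xi w i)))%:E
    = (expR (\sum_i (\sum_j a i j ^+ 2 + c i ^+ 2) / 2))%:E)%E ->
  h ^+ 2 * \sum_j y (inl j) ^+ 2 <= 3^-1 ->
  (\int[P]_w (expR (lattice_functional (design h (Z w)) (xi w) (curvature ns) y))%:E
   <= (expR (- \sum_j y j ^+ 2 / 5))%:E)%E.
Proof.
move=> n0 h2 mZ mxi mgf.
set r := h ^+ 2 * _ => r3.
have r0 : 0 <= r by rewrite mulr_ge0 ?sqr_ge0// sumr_ge0// => j _; rewrite sqr_ge0.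
(* The group columns do not involve the design, so any fixed matrix exhibits [b] as
   deterministic. *)
pose Z0 : {s : 'I_K & 'I_(ns s)} -> 'I_p -> R := fun _ _ => 0.
pose b i := design h Z0 i (inr (tag i)) * y (inr (tag i)).
pose a i w := \sum_j h * y (inl j) * Z w i j.
have ma i : measurable_fun setT (a i).
  by apply: measurable_sum => j; exact: measurable_funM.
have cE : \sum_j curvature ns j * y j ^+ 2 =
    3 / 8 * (\sum_i (r + b i ^+ 2)) - \sum_j y j ^+ 2 / 5.
  rewrite big_split/= (sum_design_group_mul_sqr Z0 (fun s => y (inr s)) n0 h2).
  have -> : \sum_(i : {s : 'I_K & 'I_(ns s)}) r = 2 * \sum_j y (inl j) ^+ 2.
    rewrite sum_samples; under eq_bigr do rewrite sumr_const card_ord -mulr_natr.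
    rewrite -mulr_sumr -natr_sum.
    by rewrite /r h2; field; rewrite gt_eqF.
  rewrite !sumr_sumType/= !mulrDr opprD addrACA !mulr_sumr -!sumrB.
  by congr (_ + _); apply: eq_bigr => j _; field.
have := @integral_exp_cross_term_le _ _ _ P _ a (fun i w => xi w i) r b ma mxi.
rewrite r0 r3 => /(_ isT) key.
rewrite (@eq_integral_expR _ _ _ P _ (fun w =>
  \sum_j curvature ns j * y j ^+ 2 +
  \sum_i ((a i w + b i) * xi w i - (a i w + b i) ^+ 2))); last first.
  move=> w; rewrite /lattice_functional addrC; congr (_ + _).
  by apply: eq_bigr => i _; rewrite design_mul.
under eq_integral do rewrite expRD EFinM.
rewrite ge0_integralZl ?lee_fin ?expR_ge0//; last first.
  apply/measurable_EFinP/measurable_expR_comp/measurable_sum => i.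
  apply: measurable_funB; last by apply: measurable_funX; exact: measurable_funD.
  by apply: measurable_funM => //; exact: measurable_funD.
apply: le_trans (lee_wpmul2l _ (key _)) _; first by rewrite lee_fin expR_ge0.
  move=> s; rewrite (@eq_integral_expR _ _ _ P _ (fun w =>
     \sum_i (\sum_j ((s i).1 * (h * y (inl j))) * Z w i j + (s i).2 * xi w i))).
    rewrite mgf; congr (expR _)%:E; apply: eq_bigr => i _; congr ((_ + _) / 2).
    rewrite /r [RHS]mulrAC mulr_sumr.
    by apply: eq_bigr => j _; ring.
  move=> w; apply: eq_bigr => i _; congr (_ + _).
  by rewrite /a mulr_sumr; apply: eq_bigr => j _; ring.
by rewrite -EFinM -expRD lee_fin ler_expR cE; lra.
Qed.

(* Optimality against the rescaled competitor [(2 lam - 1) A] gives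
   [<lam A, xi> >= |lam A|^2] for every shrinkage factor [lam] of the error. *)
Lemma shrunk_error_correlation (R : realType) (I : finType) (A xi : I -> R) (lam : R) :
  0 <= lam -> lam < 1 ->
  (forall c, \sum_i (xi i - A i) ^+ 2 <= \sum_i (xi i - c * A i) ^+ 2) ->
  0 <= \sum_i ((lam * A i) * xi i - (lam * A i) ^+ 2).
Proof.
move=> l0 l1 /(_ (2 * lam - 1)).
have sqE c : \sum_i (xi i - c * A i) ^+ 2 =
    \sum_i xi i ^+ 2 - 2 * c * (\sum_i A i * xi i) + c ^+ 2 * (\sum_i A i ^+ 2).
  rewrite !mulr_sumr -sumrB -big_split/=; apply: eq_bigr => i _; ring.
have := sqE 1; under eq_bigr do rewrite mul1r.
move=> ->; rewrite sqE => h.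
have -> : \sum_i ((lam * A i) * xi i - (lam * A i) ^+ 2) =
   lam * (\sum_i A i * xi i - lam * \sum_i A i ^+ 2).
  rewrite !mulr_sumr -sumrB mulr_sumr; apply: eq_bigr => i _; ring.
apply: mulr_ge0 => //.
(* The optimality inequality is 4 (1 - lam) times the remaining claim. *)
have d0 : 0 < 1 - lam by lra.
by rewrite -(pmulr_rge0 _ d0); move: h; lra.
Qed.

(** By contradiction: an error of squared norm E2 > r2 is shrunk to squared norm r2, which makes
    |y|^2 = 4 (p + K) + 2 t. Optimality bounds the functional at y below by 11/20 |y|^2, and a
    rounding of y then violates the lattice bound. *)
Lemma least_squares_error_le (R : realType) (p K : nat) (ns : 'I_K -> nat) (h t : R)
    (Z : {s : 'I_K & 'I_(ns s)} -> 'I_p -> R) (xi : {s : 'I_K & 'I_(ns s)} -> R)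
    (u : 'I_p -> R) (be : 'I_K -> R) (N : nat) :
  let n : R := (\sum_(s < K) ns s)%:R in
  0 < n -> 0 < h -> h ^+ 2 = 2 / n -> 1 <= t -> t / n <= 36^-1 ->
  6 * Num.sqrt (p%:R / n) + 4 * Num.sqrt (K%:R / n) + 5 * Num.sqrt (t / n) <= 7 / 9 ->
  Num.sqrt (4 * (p%:R + K%:R) + 2 * t) + 1 <= N%:R ->
  (forall c, \sum_i (xi i - (\sum_j u j * Z i j + be (tag i))) ^+ 2 <=
             \sum_i (xi i - c * (\sum_j u j * Z i j + be (tag i))) ^+ 2) ->
  \sum_i \sum_j Z i j ^+ 2 <= 3 / 2 * (n * p%:R) + 2 * t ->
  (forall k : {ffun 'I_p + 'I_K -> 'I_(N.*2.+1)},
     h ^+ 2 * \sum_j ((k (inl j))%:R - N%:R) ^+ 2 <= 3^-1 ->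
     lattice_functional (design h Z) xi (curvature ns) (fun j => (k j)%:R - N%:R)
       <= t / 2 + 36 / 25 * (p%:R + K%:R)) ->
  \sum_j u j ^+ 2 + \sum_s weight ns s * be s ^+ 2 <= (8 * (p%:R + K%:R) + 4 * t) / n.
Proof.
move=> n n0 h0 h2 t1 tn cond hN ls chi lat.
set r2 := (X in _ <= X); set E2 := (X in X <= _).
have p0 := ler0n R p; have K0 := ler0n R K.
have r20 : 0 < r2 by rewrite /r2 divr_gt0//; lra.
rewrite leNgt; apply/negP => rE.
have E20 : 0 < E2 by exact: lt_trans rE.
pose lam := Num.sqrt (r2 / E2).
have lam2 : lam ^+ 2 * E2 = r2.
  have re0 : 0 <= r2 / E2 by rewrite divr_ge0// ltW.
  by rewrite /lam (sqr_sqrtr re0) divfK// gt_eqF.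
have lam0 : 0 <= lam := sqrtr_ge0 _.
have lam1 : lam < 1.
  rewrite -(ltr_pXn2r (ltn0Sn 1)) ?nnegrE// expr1n -(ltr_pM2r E20) lam2 mul1r//.
have hn0 : h != 0 by rewrite gt_eqF.
pose y (j : 'I_p + 'I_K) : R :=
  match j with
  | inl j => lam * u j / h
  | inr s => lam * (Num.sqrt (weight ns s) * be s) / h
  end.
have hy2l : h ^+ 2 * (\sum_j y (inl j) ^+ 2) = lam ^+ 2 * \sum_j u j ^+ 2.
  by rewrite !mulr_sumr; apply: eq_bigr => j _ /=; field.
have hy2r : h ^+ 2 * (\sum_s y (inr s) ^+ 2) = lam ^+ 2 * \sum_s weight ns s * be s ^+ 2.
  rewrite !mulr_sumr; apply: eq_bigr => s _ /=.
  rewrite -[in RHS](sqr_sqrtr (weight_ge0 R ns s)); by field.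
have y2 : \sum_j y j ^+ 2 = 4 * (p%:R + K%:R) + 2 * t.
  rewrite sumr_sumType.
  have : h ^+ 2 * (\sum_j y (inl j) ^+ 2 + \sum_s y (inr s) ^+ 2) = r2.
    by rewrite mulrDr hy2l hy2r -mulrDr lam2.
  rewrite h2 /r2 => /(congr1 (fun x => x * n / 2)) e.
  transitivity (2 / n * (\sum_j y (inl j) ^+ 2 + \sum_s y (inr s) ^+ 2) * n / 2).
    by field; rewrite gt_eqF.
  by rewrite e; field; rewrite gt_eqF.
have yN j : `|y j| + 1 <= N%:R.
  apply: le_trans hN; rewrite lerD2r -sqrtr_sqr ler_sqrt -y2 ?sumr_ge0// => [|i _].
    by rewrite (bigD1 j)//= lerDl sumr_ge0// => i _; rewrite sqr_ge0.
  by rewrite sqr_ge0.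
pose A i := \sum_j u j * Z i j + be (tag i).
have yA i : \sum_j design h Z i j * y j = lam * A i.
  rewrite design_mul /A mulrDr mulr_sumr; congr (_ + _).
    by apply: eq_bigr => j _ /=; field.
  have ns0 : ns (tag i) != 0%N by rewrite -lt0n (leq_ltn_trans _ (ltn_ord (tagged i))).
  have sw : Num.sqrt (weight ns (tag i)) != 0 :> R.
    by rewrite gt_eqF// sqrtr_gt0 weight_gt0.
  by rewrite /= eqxx mulr1n; field; rewrite hn0 sw.
have Fy : 11 / 20 * (4 * (p%:R + K%:R) + 2 * t) <=
    lattice_functional (design h Z) xi (curvature ns) y.
  rewrite /lattice_functional; under eq_bigr do rewrite yA.
  have -> : \sum_j curvature ns j * y j ^+ 2 = 11 / 20 * (4 * (p%:R + K%:R) + 2 * t).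
    rewrite -y2 mulr_sumr; apply: eq_bigr => -[j|s] _ //=.
    (* An empty group has weight 0, so its coordinate of [y] vanishes; all other curvatures are
       11/20. *)
    have [ns0|ns0] := eqVneq (ns s) 0%N; last by congr (_ * _); rewrite /=; lra.
    by rewrite /weight ns0 mul0r sqrtr0 mul0r mulr0 mul0r expr0n/= !mulr0.
  by rewrite lerDr; exact: shrunk_error_correlation.
(* Bounds on the concavity in each coordinate; 29/20 = 2 - 11/20 for a nonempty group. *)
pose a (j : 'I_p + 'I_K) : R :=
  match j with inl j => h ^+ 2 * \sum_i Z i j ^+ 2 | inr s => 29 / 20 end.
have a0 j : 0 <= a j.
  case: j => [j|s] /=; last by lra.
  by rewrite mulr_ge0 ?sqr_ge0// sumr_ge0// => i _; rewrite sqr_ge0.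
have ga_a j : - a j <= curvature ns j - \sum_i design h Z i j ^+ 2.
  case: j => [j|s] /=.
    have -> : \sum_i (h * Z i j) ^+ 2 = h ^+ 2 * \sum_i Z i j ^+ 2.
      by rewrite mulr_sumr; apply: eq_bigr => i _; rewrite exprMn.
    lra.
  rewrite (sum_design_group_sqr Z s n0 h2); case: (ns s != 0%N) => /=; lra.
have [k [k1 k2]] := round_coordinates a0 ga_a yN
  (fun z j => lattice_functional_quadratic (design h Z) xi (curvature ns) z j).
(* By Minkowski's inequality, rounding lengthens the slope part by at most sqrt (h^2 p) = sqrt
   (2p/n). *)
have valid : h ^+ 2 * \sum_j ((k (inl j))%:R - N%:R) ^+ 2 <= 3^-1.
  have P0 := sqrtr_ge0 (p%:R / n); have Q0 := sqrtr_ge0 (K%:R / n).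
  have T0 := sqrtr_ge0 (t / n).
  have P2 : Num.sqrt (p%:R / n) ^+ 2 = p%:R / n by rewrite sqr_sqrtr// divr_ge0// ltW.
  have Q2 : Num.sqrt (K%:R / n) ^+ 2 = K%:R / n by rewrite sqr_sqrtr// divr_ge0// ltW.
  have T2 : Num.sqrt (t / n) ^+ 2 = t / n by rewrite sqr_sqrtr// divr_ge0 ?ltW//; lra.
  have [] := @rounding_radius R _ _ _ r2 P0 Q0 T0 cond.
    by rewrite P2 Q2 T2 /r2 le_eqVlt; apply/orP; left; apply/eqP; ring.
  rewrite P2 => hA [hB hAB]; apply: le_trans hAB.
  have -> : h ^+ 2 * \sum_j ((k (inl j))%:R - N%:R) ^+ 2 = 0 + \sum_(j < p) 1 *
     (h * y (inl j) + h * ((k (inl j))%:R - N%:R - y (inl j))) ^+ 2.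
    by rewrite add0r mulr_sumr; apply: eq_bigr => j _; ring.
  apply: weighted_minkowski => //.
    apply: le_trans hA; rewrite add0r.
    under eq_bigr do rewrite mul1r exprMn.
    rewrite -mulr_sumr hy2l -lam2 ler_wpM2l ?sqr_ge0// lerDl sumr_ge0// => s _.
    by rewrite mulr_ge0 ?sqr_ge0// weight_ge0.
  apply: le_trans hB.
  have -> : 2 * (p%:R / n) = \sum_(j < p) h ^+ 2.
    by rewrite sumr_const card_ord -[RHS]mulr_natr h2; ring.
  apply: ler_sum => j _; rewrite mul1r exprMn ler_piMr ?sqr_ge0//.
  by rewrite -real_normK ?num_real// exprn_ile1.
have := le_trans k2 (lat k valid).
have -> : \sum_j a j = h ^+ 2 * (\sum_i \sum_j Z i j ^+ 2) + 29 / 20 * K%:R.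
  rewrite sumr_sumType/= sumr_const card_ord mulr_natr -mulr_sumr.
  by congr (_ * _ + _); exact: exchange_big.
have chi' : h ^+ 2 * (\sum_i \sum_j Z i j ^+ 2) <= 3 * p%:R + 4 * (t / n).
  apply: le_trans (ler_wpM2l (sqr_ge0 h) chi) _.
  rewrite h2 le_eqVlt; apply/orP; left; apply/eqP.
  by field; rewrite gt_eqF.
(* The balance per unit is 11/5 - 3/4 = 29/20 > 36/25 for p and 11/5 - 29/80 > 36/25 for K, while
   11/10 t - t/n > t/2 because t >= 1. *)
move: Fy chi' tn t1 p0 K0; clear; lra.
Qed.

(** * Exponential moments behind the good event *)

Lemma sum_samples_cst (R : realType) (K : nat) (ns : 'I_K -> nat) (r : R) :
  \sum_(i : {s : 'I_K & 'I_(ns s)}) r = r * (\sum_(s < K) ns s)%:R.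
Proof.
rewrite sum_samples; under eq_bigr do rewrite sumr_const card_ord -mulr_natr.
by rewrite -mulr_sumr -natr_sum.
Qed.

(** e^(3/4) >= (1 + 1/8)^6 >= 2. *)
Lemma ln2_le (R : realType) : ln 2 <= 3 / 4 :> R.
Proof.
rewrite -ler_expR lnK ?posrE//; apply: le_trans (expR_lower_bound 5 _); last by lra.
have -> : 1 + 3 / 4 / 6%:R = 9 / 8 :> R by field.
rewrite (exprM _ 2 3) (_ : (9 / 8) ^+ 2 = 81 / 64 :> R); last by field.
have h : 8 / 5 <= (81 / 64 : R) ^+ 2 by rewrite expr2; lra.
rewrite exprS; apply: le_trans (ler_wpM2l _ h); lra.
Qed.

(** Markov's inequality for the complement. *)
Lemma probability_le_ge d (T : measurableType d) (R : realType) (P : probability T R)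
    (S : T -> R) (c m : R) : measurable_fun setT S -> (forall x, 0 <= S x) -> 0 < c ->
  (\int[P]_x (S x)%:E <= m%:E)%E ->
  measurable [set x | S x <= c] /\ ((1 - m / c)%:E <= P [set x | (S x <= c)%R])%E.
Proof.
move=> mS S0 c0 Sm; pose A := [set x | S x <= c].
have mA : measurable A.
  have -> : A = setT `&` S @^-1` `]-oo, c].
    by rewrite setTI; apply/seteqP; split => x /=; rewrite in_itv.
  by apply: mS => //; exact: measurable_itv.
split => //.
have mCA : measurable (~` A) by exact: measurableC.
have h : (c%:E * P (~` A) <= m%:E)%E.
  rewrite -(integral_cst P mCA c%:E); apply: le_trans Sm.
  apply: (@le_trans _ _ (\int[P]_(x in ~` A) (S x)%:E)%E).
    apply: ge0_le_integral => //.
    - by move=> x _; rewrite lee_fin ltW.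
    - by apply/measurable_EFinP; exact: measurable_funTS.
    - by move=> x /negP; rewrite -ltNge lee_fin => /ltW.
  apply: ge0_subset_integral => //; first exact/measurable_EFinP.
  by move=> x _; rewrite lee_fin.
have PA : P A = (1 - P (~` A))%E.
  by rewrite -probability_setC ?setCK//; exact: measurableC.
have [q qE] : exists q, P (~` A) = q%:E.
  by exists (fine (P (~` A))); rewrite fineK//; exact: fin_num_measure.
rewrite PA qE lee_fin; rewrite qE lee_fin in h.
by rewrite lerD2l lerN2 ler_pdivlMr// mulrC.
Qed.

(** Each of the n p coordinates contributes sqrt 2 <= e^(3/8). *)
Lemma integral_chi2_weight_le1 d (T : measurableType d) (R : realType)
    (P : probability T R) (p K : nat) (ns : 'I_K -> nat)
    (Z : T -> {s : 'I_K & 'I_(ns s)} -> 'I_p -> R)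
    (xi : T -> {s : 'I_K & 'I_(ns s)} -> R) :
  (forall i j, measurable_fun setT (fun w => Z w i j)) ->
  (forall (a : {s : 'I_K & 'I_(ns s)} -> 'I_p -> R) c,
    \int[P]_w (expR (\sum_i (\sum_j a i j * Z w i j + c i * xi w i)))%:E
    = (expR (\sum_i (\sum_j a i j ^+ 2 + c i ^+ 2) / 2))%:E)%E ->
  (\int[P]_w (expR (4^-1 * \sum_i \sum_j Z w i j ^+ 2
                    - 3 / 8 * ((\sum_(s < K) ns s)%:R * p%:R)))%:E <= 1)%E.
Proof.
move=> mZ mgf; set m := (\sum_(s < K) ns s)%:R * p%:R : R.
pose g (q : {s : 'I_K & 'I_(ns s)} * 'I_p) w := Z w q.1 q.2.
have H (a : {s : 'I_K & 'I_(ns s)} * 'I_p -> R) :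
    (\int[P]_x (expR (\sum_q a q * g q x))%:E = (expR (\sum_q (a q) ^+ 2 / 2))%:E)%E.
  rewrite (@eq_integral_expR _ _ _ P _ (fun w =>
     \sum_i (\sum_j a (i, j) * Z w i j + 0 * xi w i))); last first.
    move=> w; under [RHS]eq_bigr do rewrite mul0r addr0.
    by rewrite pair_big/=; apply: eq_bigr => -[].
  rewrite (mgf (fun i j => a (i, j)) (fun=> 0)); congr (expR _)%:E.
  under eq_bigr do rewrite expr0n/= addr0 mulr_suml.
  by rewrite pair_big/=; apply: eq_bigr => -[].
have := integral_exp_chi2 (fun q => mZ q.1 q.2) H.
have -> : \sum_(q : {s : 'I_K & 'I_(ns s)} * 'I_p) ln 2 / 2 = ln 2 / 2 * m :> R.
  rewrite -(pair_big xpredT xpredT (fun _ _ => ln 2 / 2))/=.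
  under eq_bigr do rewrite sumr_const card_ord -(mulr_natr (ln 2 / 2)).
  by rewrite sum_samples_cst /m -mulrA; congr (_ * _); rewrite mulrC.
move=> chi; rewrite (@eq_integral_expR _ _ _ P _ (fun w =>
   - (3 / 8 * m) + \sum_q 4^-1 * g q w ^+ 2)); last first.
  by move=> w; rewrite -mulr_sumr addrC pair_big.
under eq_integral do rewrite expRD EFinM.
rewrite ge0_integralZl ?lee_fin ?expR_ge0//; last first.
  apply/measurable_EFinP/measurable_expR_comp/measurable_sum => q.
  by apply: measurable_funM => //; apply: measurable_funX; exact: mZ.
rewrite chi -EFinM -expRD lee_fin; apply: (@le_trans _ _ (expR 0)); last by rewrite expR0.
rewrite ler_expR.
have : ln 2 / 2 * m <= 3 / 8 * m.
  by rewrite ler_wpM2r ?mulr_ge0//; have := ln2_le R; clear; lra.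
by clear; lra.
Qed.

(** Each admissible lattice point contributes at most its weight in [lattice_prior_le1]; one
    integral thus controls all points simultaneously. *)
Lemma integral_lattice_sum_le1 d (T : measurableType d) (R : realType)
    (P : probability T R) (p K : nat) (ns : 'I_K -> nat) (h : R) (N : nat)
    (Z : T -> {s : 'I_K & 'I_(ns s)} -> 'I_p -> R)
    (xi : T -> {s : 'I_K & 'I_(ns s)} -> R) :
  (0 : R) < (\sum_(s < K) ns s)%:R -> h ^+ 2 = 2 / (\sum_(s < K) ns s)%:R ->
  (forall i j, measurable_fun setT (fun w => Z w i j)) ->
  (forall i, measurable_fun setT (fun w => xi w i)) ->
  (forall (a : {s : 'I_K & 'I_(ns s)} -> 'I_p -> R) c,
    \int[P]_w (expR (\sum_i (\sum_j a i j * Z w i j + c i * xi w i)))%:E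
    = (expR (\sum_i (\sum_j a i j ^+ 2 + c i ^+ 2) / 2))%:E)%E ->
  let F w (k : {ffun 'I_p + 'I_K -> 'I_(N.*2.+1)}) :=
    expR (lattice_functional (design h (Z w)) (xi w) (curvature ns)
            (fun j => (k j)%:R - N%:R) - 36 / 25 * (p%:R + K%:R)) in
  (forall k, measurable_fun setT (F^~ k)) /\
  (\int[P]_w (\sum_(k : {ffun 'I_p + 'I_K -> 'I_(N.*2.+1)} |
      h ^+ 2 * \sum_j ((k (inl j))%:R - N%:R) ^+ 2 <= 3^-1) F w k)%:E
    <= 1)%E.
Proof.
move=> n0 h2 mZ mxi mgf F.
have mPhi (y : 'I_p + 'I_K -> R) : measurable_fun setT (fun w =>
    lattice_functional (design h (Z w)) (xi w) (curvature ns) y).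
  have mA i : measurable_fun setT (fun w => \sum_j design h (Z w) i j * y j).
    by apply: measurable_sum => -[j|s]; apply: measurable_funM => //; exact: measurable_funM.
  apply: measurable_funD => //; apply: measurable_sum => i.
  by apply: measurable_funB; [exact: measurable_funM|exact: measurable_funX].
have mF k : measurable_fun setT (F^~ k).
  by apply: measurable_expR_comp; apply: measurable_funD.
split => //.
under eq_integral do rewrite -sumEFin -big_filter.
rewrite ge0_integral_sum//; last 2 first.
- by move=> k; exact/measurable_EFinP.
- by move=> k w _; rewrite lee_fin expR_ge0.
rewrite big_filter.
apply: (@le_trans _ _ (\sum_(k : {ffun 'I_p + 'I_K -> 'I_(N.*2.+1)})
   (expR (- (\sum_j ((k j)%:R - N%:R) ^+ 2 / 5)
          - 36 / 25 * #|{: 'I_p + 'I_K}|%:R))%:E)%E); last first.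
  by rewrite sumEFin lee_fin; exact: lattice_prior_le1.
rewrite big_mkcond; apply: lee_sum => k _; case: ifPn => [valid|_]; last first.
  by rewrite lee_fin expR_ge0.
rewrite card_sum !card_ord natrD.
rewrite (@eq_integral_expR _ _ _ P _ (fun w => - (36 / 25 * (p%:R + K%:R)) +
  lattice_functional (design h (Z w)) (xi w) (curvature ns)
            (fun j => (k j)%:R - N%:R))); last by move=> w; rewrite addrC.
under eq_integral do rewrite expRD EFinM.
rewrite ge0_integralZl ?lee_fin ?expR_ge0//; last first.
  by apply/measurable_EFinP/measurable_expR_comp.
rewrite [X in (_ <= (expR X)%:E)%E]addrC expRD EFinM lee_wpmul2l ?lee_fin ?expR_ge0//.
exact: (integral_lattice_functional_le n0 h2 mZ mxi mgf).
Qed.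

Lemma ls_obj_weightE (R : realType) (p K : nat) (ns : 'I_K -> nat)
    (Xs : forall s : 'I_K, 'M[R]_(ns s, p)) (Ys : forall s : 'I_K, 'cV[R]_(ns s))
    (beta : 'rV[R]_p) (b : 'I_K -> R) :
  ls_obj (weight ns) Xs Ys beta b = (\sum_(s < K) ns s)%:R^-1 *
    \sum_(i : {s : 'I_K & 'I_(ns s)}) (Ys (tag i) (tagged i) 0 - dotv (row (tagged i) (Xs (tag i))) beta
            - b (tag i)) ^+ 2.
Proof.
rewrite sum_samples mulr_sumr /ls_obj; apply: eq_bigr => s _ /=.
(* For a nonempty group w_s/n_s = 1/n; an empty group has no terms. *)
have [ns0|ns0] := eqVneq (ns s) 0%N.
  rewrite big1 ?mulr0// => i _; exfalso.
  by have := ltn_ord i; rewrite [X in (_ < X)%N]ns0.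
rewrite mulrA; congr (_ * _); rewrite /weight mulrAC divff ?mul1r//.
by rewrite pnatr_eq0.
Qed.

(** * From the good event to the fairness and risk bounds *)

Unset Implicit Arguments.
Set Strict Implicit.

Theorem theorem3
  (R : realType)
  (* probability space carrying the sample *)
  (d : measure_display) (Omega : measurableType d) (P : probability Omega R)
  (* auxiliary probability space carrying a fresh design X ~ N(0,Sigma) *)
  (d' : measure_display) (T : measurableType d') (Q : probability T R)
  (p K : nat) (ns : 'I_K -> nat)
  (Sigma : 'M[R]_p) (sigma : R) (bstar : 'rV[R]_p) (bs : 'I_K -> R)
  (X : forall s : 'I_K, Omega -> 'M[R]_(ns s, p))
  (xi : forall s : 'I_K, Omega -> 'cV[R]_(ns s))
  (Xnew : T -> 'rV[R]_p)
  (betahat : Omega -> 'rV[R]_p) (bhat : Omega -> 'I_K -> R)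
  (t alpha : R) :
  (* Sigma symmetric positive definite, sigma > 0 *)
  Sigma^T = Sigma ->
  (forall u : 'rV[R]_p, u != 0 -> 0 < qform Sigma u) ->
  0 < sigma ->
  (* X ~ N(0, Sigma): a Gaussian vector (every linear form is Gaussian) *)
  (forall j : 'I_p, measurable_fun setT (fun x => Xnew x 0 j)) ->
  (forall (u : 'rV[R]_p) (A : set R), measurable A ->
     law Q (fun x => dotv u (Xnew x)) A = gauss_law 0 (qform Sigma u) A) ->
  (* the sample: (X_1,...,X_K, xi_1,...,xi_K) is a centered Gaussian vector
     whose rows of the X_s are i.i.d. N(0,Sigma), entries of xi_s i.i.d.
     N(0,sigma^2), all independent; stated via linear forms *)
  (forall s i j, measurable_fun setT (fun w => X s w i j)) ->
  (forall s i, measurable_fun setT (fun w => xi s w i 0)) ->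
  (forall (A : forall s : 'I_K, 'M[R]_(ns s, p))
          (c : forall s : 'I_K, 'cV[R]_(ns s)) (B : set R), measurable B ->
     law P (fun w => \sum_(s < K) (\sum_(i < ns s) \sum_(j < p) A s i j * X s w i j
                                  + \sum_(i < ns s) c s i 0 * xi s w i 0)) B
     = gauss_law 0 (\sum_(s < K) (\sum_(i < ns s) qform Sigma (row i (A s))
                                  + sigma ^+ 2 * \sum_(i < ns s) c s i 0 ^+ 2)) B) ->
  (* (betahat, bhat) is a least-squares estimator, with
     Y_s = X_s beta* + b*_s 1 + xi_s *)
  (forall (w : Omega) (beta : 'rV[R]_p) (b : 'I_K -> R),
     ls_obj (weight ns) (X^~ w)
       (fun s => \col_i (dotv (row i (X s w)) bstar + bs s + xi s w i 0))
       (betahat w) (bhat w)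
     <= ls_obj (weight ns) (X^~ w)
       (fun s => \col_i (dotv (row i (X s w)) bstar + bs s + xi s w i 0))
       beta b) ->
  0 <= t ->
  0 <= alpha <= 1 ->
  let n : R := (\sum_(s < K) ns s)%:R in
  let delta := delta_n n p%:R K%:R t in
  let th := theta p%:R K%:R t in
  2 * (Num.sqrt p%:R + Num.sqrt t) / (th - Num.sqrt (th ^+ 2 - 3)) <= Num.sqrt n ->
  let U := unfairness Q Xnew (weight ns) in
  let Rk := risk Q Xnew (weight ns) bstar bs in
  exists E : set Omega, measurable E /\
    ((1 - 4 * expR (- t / 2))%:E <= P E)%E /\
    forall w, E w ->
      let tau := tau_hat alpha sigma delta
                   (fine (sqrte (U (f_tau (weight ns) 1 (betahat w) (bhat w))))) in
      let fh := f_tau (weight ns) tau (betahat w) (bhat w) in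
      (U fh <= alpha%:E * U (fstar bstar bs))%E /\
      (sqrte (Rk fh) <= (2 * sigma * (1 + Num.sqrt alpha) * Num.sqrt delta)%:E
                        + (1 - Num.sqrt alpha)%:E * sqrte (U (fstar bstar bs)))%E.
Proof.
move=> Ssym Spos sig0 mXnew HXnew mX mxi Hsample LS t0 a01 n delta th hyp U Rk.
have n0' : 0 <= n by exact: ler0n.
(* For t < 1 the required probability is negative, and the empty event will do. *)
have [t1|t1] := ltP t 1.
  exists set0; split => //; split => [|w []].
  rewrite measure0 lee_fin; have := expR_ge1Dx (- t / 2); lra.
have t_gt0 : 0 < t by lra.
have [n0 [cond tn]] :=
  sample_size_condition (ler0n R p) (ler0n R K) t_gt0 n0' hyp.
have [B BSB] := whitening Ssym Spos.
pose h := Num.sqrt (2 / n).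
have h0 : 0 < h by rewrite sqrtr_gt0 divr_gt0.
have h2 : h ^+ 2 = 2 / n by rewrite sqr_sqrtr// divr_ge0.
pose Z w := whitened B (X^~ w).
pose xi' w (i : {s : 'I_K & 'I_(ns s)}) : R := xi (tag i) w (tagged i) 0 / sigma.
have mZ i j : measurable_fun setT (fun w => Z w i j).
  apply: measurable_sum => k; apply: measurable_funM => //.
  by under eq_fun do rewrite mxE; exact: mX.
have mxi' i : measurable_fun setT (fun w => xi' w i) by exact: measurable_funM.
have mgf := sample_mgf BSB sig0 mX mxi Hsample.
(* Two above the truncation, hence at least one above the root itself. *)
pose N := (Num.truncn (Num.sqrt (4 * (p%:R + K%:R) + 2 * t) : R)).+2.
have hN : Num.sqrt (4 * (p%:R + K%:R) + 2 * t) + 1 <= N%:R :> R.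
  rewrite /N -(natr1 (Num.truncn _).+1) lerD2r.
  by have /andP[_ /ltW] := truncn_itv (sqrtr_ge0 (4 * (p%:R + K%:R) + 2 * t) : (0 : R) <= _).
pose F w (k : {ffun 'I_p + 'I_K -> 'I_(N.*2.+1)}) : R :=
  expR (lattice_functional (design h (Z w)) (xi' w) (curvature ns)
          (fun j => (k j)%:R - N%:R) - 36 / 25 * (p%:R + K%:R)).
(* Two statistics of mean at most 1: [S1] controls the size of the design, [S2] all lattice
   points. *)
pose S1 w := expR (4^-1 * (\sum_i \sum_j Z w i j ^+ 2) - 3 / 8 * (n * p%:R)).
pose S2 w := \sum_(k : {ffun 'I_p + 'I_K -> 'I_(N.*2.+1)} |
  h ^+ 2 * \sum_j ((k (inl j))%:R - N%:R) ^+ 2 <= 3^-1) F w k.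
have [mF intF] : (forall k, measurable_fun setT (F^~ k)) /\
    (\int[P]_w (S2 w)%:E <= 1)%E.
  exact: (integral_lattice_sum_le1 N n0 h2 mZ mxi' mgf).
have mS1 : measurable_fun setT S1.
  apply: measurable_expR_comp; apply: measurable_funD => //.
  apply: measurable_funM => //; apply: measurable_sum => i.
  by apply: measurable_sum => j; exact: measurable_funX.
have mS2 : measurable_fun setT S2 by exact: measurable_sum_cond.
have S10 w : 0 <= S1 w by exact: expR_ge0.
have S20 w : 0 <= S2 w by apply: sumr_ge0 => k _; exact: expR_ge0.
have intS : (\int[P]_w (S1 w + S2 w)%:E <= 2%:E)%E.
  under eq_integral do rewrite EFinD.
  rewrite ge0_integralD//; last 4 first.
  - by move=> w _; rewrite lee_fin.
  - exact/measurable_EFinP.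
  - by move=> w _; rewrite lee_fin.
  - exact/measurable_EFinP.
  have -> : 2%:E = (1 + 1)%E :> \bar R by rewrite -EFinD.
  by apply: leeD => //; exact: (integral_chi2_weight_le1 mZ mgf).
(* Markov at level e^(t/2) for a sum of mean at most 2. *)
have [mE PE] := @probability_le_ge _ _ _ P (fun w => S1 w + S2 w) (expR (t / 2)) 2
  (measurable_funD mS1 mS2) (fun w => addr_ge0 (S10 w) (S20 w)) (expR_gt0 _) intS.
exists [set w | S1 w + S2 w <= expR (t / 2)]; split => //; split.
  apply: le_trans PE; rewrite lee_fin lerD2l lerN2 mulNr expRN ler_wpM2r ?invr_ge0 ?expR_ge0//.
  by rewrite ler_nat.
move=> w /= Ew.
have S1w : S1 w <= expR (t / 2) by have := S20 w; lra.
have S2w : S2 w <= expR (t / 2) by have := S10 w; lra.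
have chi : \sum_i \sum_j Z w i j ^+ 2 <= 3 / 2 * (n * p%:R) + 2 * t.
  by move: S1w; rewrite ler_expR; lra.
have lat (k : {ffun 'I_p + 'I_K -> 'I_(N.*2.+1)}) :
     h ^+ 2 * \sum_j ((k (inl j))%:R - N%:R) ^+ 2 <= 3^-1 ->
     lattice_functional (design h (Z w)) (xi' w) (curvature ns) (fun j => (k j)%:R - N%:R)
       <= t / 2 + 36 / 25 * (p%:R + K%:R).
  move=> valid; rewrite -lerBlDr -ler_expR; apply: le_trans S2w.
  rewrite /S2 (bigD1 k)//= -[X in X <= _]addr0 lerD//.
  by apply: sumr_ge0 => i _; exact: expR_ge0.
(* The error in whitened coordinates and in units of sigma. *)
pose D := betahat w - bstar.
have Bu : B \in unitmx by move: BSB; rewrite -mulmxA => /mulmx1_unit[].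
pose v := D *m invmx B.
have vB : v *m B = D by rewrite mulmxKV.
pose u (j : 'I_p) := v 0 j / sigma.
pose be (s : 'I_K) := (bhat w s - bs s) / sigma.
have sn0 : sigma != 0 by rewrite gt_eqF.
have ls c : \sum_i (xi' w i - (\sum_j u j * Z w i j + be (tag i))) ^+ 2 <=
    \sum_i (xi' w i - c * (\sum_j u j * Z w i j + be (tag i))) ^+ 2.
  have dE i : dotv (row (tagged i) (X (tag i) w)) D = sigma * \sum_j u j * Z w i j.
    rewrite -vB dotv_mulmx mulr_sumr; apply: eq_bigr => j _.
    by rewrite /u /Z /whitened; field.
  (* Competitors on the line through the truth and the estimator; c' = 1 is the estimator itself. *)
  have objE c' : ls_obj (weight ns) (X^~ w)
       (fun s => \col_i (dotv (row i (X s w)) bstar + bs s + xi s w i 0))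
       (bstar + c' *: D) (fun s => bs s + c' * (bhat w s - bs s)) =
     n^-1 * sigma ^+ 2 *
     \sum_i (xi' w i - c' * (\sum_j u j * Z w i j + be (tag i))) ^+ 2.
    rewrite ls_obj_weightE -mulrA; congr (_ * _); rewrite mulr_sumr.
    apply: eq_bigr => i _; rewrite mxE -exprMn; congr (_ ^+ 2).
    by rewrite dotvDZr dE /xi' /be; field.
  have := LS w (bstar + c *: D) (fun s => bs s + c * (bhat w s - bs s)).
  rewrite objE; have := objE 1.
  rewrite (_ : bstar + 1 *: D = betahat w); last by rewrite scale1r addrC subrK.
  rewrite (_ : (fun s => bs s + 1 * (bhat w s - bs s)) = bhat w); last first.
    by apply/funext => s; ring.
  move=> ->; rewrite ler_pM2l; last by rewrite mulr_gt0 ?invr_gt0 ?exprn_gt0.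
  by under eq_bigr do rewrite mul1r.
have err := least_squares_error_le n0 h0 h2 t1 tn cond hN ls chi lat.
have w0 (s : 'I_K) : 0 <= weight ns s :> R := weight_ge0 R ns s.
have w1 := sum_weight n0.
(* Drops the cross term of [delta_n] and uses 4 <= 32. *)
have d0 : (8 * (p%:R + K%:R) + 4 * t) / n <= delta.
  have PT : 0 <= (Num.sqrt (p%:R / n) + Num.sqrt (K%:R / n)) * Num.sqrt (t / n).
    by rewrite mulr_ge0 ?addr_ge0 ?sqrtr_ge0.
  have tn0 : 0 <= t / n by rewrite divr_ge0// ltW.
  have -> : (8 * (p%:R + K%:R) + 4 * t) / n = 8 * (p%:R / n + K%:R / n) + 4 * (t / n).
    by ring.
  by rewrite /delta /delta_n -!mulrA; lra.
have delta0 : 0 <= delta.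
  by apply: le_trans d0; rewrite divr_ge0// addr_ge0// mulr_ge0// addr_ge0.
apply: (fair_estimator_bounds w0 w1 Spos mXnew HXnew a01 sig0 delta0).
apply: le_trans (ler_wpM2l (sqr_ge0 sigma) (le_trans err d0)).
rewrite -/D -vB (qform_whitened _ BSB) mulrDr !mulr_sumr le_eqVlt.
apply/orP; left; apply/eqP; congr (_ + _); apply: eq_bigr => s _.
  by rewrite /u; field.
by rewrite /be; field.
Qed.
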